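(* Let $P_1,\dots,P_m\in F[y]$ be polynomials in one variable, and let $V$ be the $\Delta$-closure in $\mathbb P^1$ of the set $\{y\in\mathbb A^1:\ \delta_i y-P_i(y)=0 \text{ for all } i=1,\dots,m\}$. Then $V$ is $\Delta$-complete.
   Context: $\Delta=\{\delta_1,\dots,\delta_m\}$ is a finite set of commuting derivations; $F$ is a model of $DCF_{0,m}$ and all points lie in a very saturated model $\mathcal U\supseteq F$ of $DCF_{0,m}$. $\Delta$-closed subsets of $\mathbb P^n$ are zero sets of $\Delta$-homogeneous $\Delta$-polynomials, and the $\Delta$-closure of a set is the smallest $\Delta$-closed set containing it. A $\Delta$-closed set $X\subseteq\mathbb P^n$ is $\Delta$-complete if for every quasi-projective $\Delta$-variety $Y$ the projection $X\times Y\to Y$ maps $\Delta$-closed subsets of $X\times Y$ to $\Delta$-closed subsets of $Y$. *)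

(* Defs.v *)
From HB Require Import structures.
From mathcomp Require Import all_boot all_order all_algebra.
From mathcomp Require Import finmap monalg.
From mathcomp Require Import boolp classical_sets cardinality.

Set Implicit Arguments.
Unset Strict Implicit.
Unset Printing Implicit Defensive.

Import GRing.Theory.
Local Open Scope ring_scope.
Local Open Scope classical_set_scope.

Record dfieldType (m : nat) := DField {
  dfield_sort :> fieldType;
  der : 'I_m -> dfield_sort -> dfield_sort;
  derD : forall i, {morph der i : x y / x + y};
  derM : forall i x y, der i (x * y) = der i x * y + x * der i y;
  derC : forall i j x, der i (der j x) = der j (der i x);
  dfield_char0 : [pchar dfield_sort] =i pred0
}.

Definition dmorphism m (K L : dfieldType m) (e : K -> L) :=
  forall i x, e (der i x) = der i (e x).

(* alpha : {ffun 'I_m -> nat} encodes the operator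
   theta = delta_1^(alpha 1) ... delta_m^(alpha m). *)
Definition theta m (A : Type) (d : 'I_m -> A -> A)
    (alpha : {ffun 'I_m -> nat}) (x : A) : A :=
  foldr (fun i y => iter (alpha i) (d i) y) x (enum 'I_m).

(* Delta-polynomials K{x_i : i in I} are the polynomials over K in the
   algebraic indeterminates theta x_i, the latter encoded by (i, alpha). K is
   an argument of dvar only so that dpoly K I determines m. *)
Definition dvar (m : nat) (K : dfieldType m) (I : choiceType) : choiceType :=
  (I * {ffun 'I_m -> nat})%type.

Notation dpoly K I := {malg K[{cmonom (dvar K I)}]}.

Section DPoly.
Variables (m : nat) (K : dfieldType m) (I : choiceType).
Implicit Types (v : dvar K I) (M : {cmonom (dvar K I)}) (f : dpoly K I).

Definition dpX (i : I) : dpoly K I :=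
  << ucm ((i, [ffun=> 0%N]) : dvar K I) >>.

Definition dvar_der (i : 'I_m) v : dvar K I :=
  (v.1, [ffun j => (v.2 j + (j == i))%N]).

Definition dmon_der (i : 'I_m) M : dpoly K I :=
  \sum_(v <- finsupp M)
    (M v)%:R *: << mulcm (divcm M (ucm v)) (ucm (dvar_der i v)) >>.

Definition dpder (i : 'I_m) f : dpoly K I :=
  \sum_(M <- msupp f) (<< der i f@_M *g M >> + f@_M *: dmon_der i M).

(* Value of f at a : I -> A, where A is a K-algebra via h with operators d. *)
Definition dpeval (A : comNzRingType) (h : K -> A) (d : 'I_m -> A -> A)
    (a : I -> A) f : A :=
  mmap h (fun M => \prod_(v <- finsupp M) theta d v.2 (a v.1) ^+ M v) f.

End DPoly.

(* f is Delta-homogeneous of degree d in the variables x_i with i in B: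
   replacing these x_i by t x_i multiplies f by t^d, as an identity in the
   Delta-polynomial ring K{t, x_i : i in I}; t is the variable None. *)
Definition dhomog m (K : dfieldType m) (I : choiceType) (B : pred I) (d : nat)
    (f : dpoly K I) :=
  let t : dpoly K (option I) := dpX K None in
  let x i : dpoly K (option I) := dpX K (Some i) in
  let subst := dpeval (fun c : K => c%:MP) (@dpder m K (option I)) in
  subst (fun i => if B i then t * x i else x i) f = t ^+ d * subst x f.

(* The models of DCF_{0,m} are the existentially closed Delta-fields. *)
Definition DCF m (K : dfieldType m) :=
  forall (L : dfieldType m) (e : {rmorphism K -> L}), dmorphism e ->
  forall (n : nat) (s : seq (dpoly K 'I_n)) (g : dpoly K 'I_n),
    (exists a : 'I_n -> L,
       (forall f, f \in s -> dpeval e (@der m L) a f = 0)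
       /\ dpeval e (@der m L) a g <> 0) ->
    exists a : 'I_n -> K,
      (forall f, f \in s -> dpeval idfun (@der m K) a f = 0)
      /\ dpeval idfun (@der m K) a g <> 0.

(* First-order formulas of the language of rings with m unary operators,
   with n free variables and parameters from C; in FEx the bound variable
   is the variable 0. *)
Inductive dterm (m : nat) (C : Type) (n : nat) : Type :=
  | TVar of 'I_n
  | TPar of C
  | TZero
  | TOne
  | TAdd of dterm m C n & dterm m C n
  | TOpp of dterm m C n
  | TMul of dterm m C n & dterm m C n
  | TDer of 'I_m & dterm m C n.

Inductive dformula (m : nat) (C : Type) : nat -> Type :=
  | FEq n of dterm m C n & dterm m C n : dformula m C n
  | FNot n of dformula m C n : dformula m C n
  | FAnd n of dformula m C n & dformula m C n : dformula m C n
  | FEx n of dformula m C n.+1 : dformula m C n.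

Section Semantics.
Variables (m : nat) (U : dfieldType m) (C : Type) (par : C -> U).

Fixpoint tval n (a : 'I_n -> U) (t : dterm m C n) : U :=
  match t with
  | TVar i => a i
  | TPar c => par c
  | TZero => 0
  | TOne => 1
  | TAdd t1 t2 => tval a t1 + tval a t2
  | TOpp t1 => - tval a t1
  | TMul t1 t2 => tval a t1 * tval a t2
  | TDer i t1 => der i (tval a t1)
  end.

Fixpoint fholds n (phi : dformula m C n) : ('I_n -> U) -> Prop :=
  match phi in dformula _ _ n return ('I_n -> U) -> Prop with
  | FEq _ t u => fun a => tval a t = tval a u
  | FNot _ p => fun a => ~ fholds p a
  | FAnd _ p q => fun a => fholds p a /\ fholds q a
  | FEx _ p => fun a => exists x : U,
      fholds p (fun i => if unlift ord0 i is Some j then a j else x)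
  end.

End Semantics.

(* U is |F|^+-saturated. *)
Definition saturated_over m (F U : dfieldType m) :=
  forall A : set U, (A #<= [set: F])%card ->
  forall (n : nat) (Sigma : set (dformula m {x : U | A x} n)),
    (forall Sigma0, Sigma0 `<=` Sigma -> finite_set Sigma0 ->
       exists a, forall phi, Sigma0 phi -> fholds sval phi a) ->
    exists a, forall phi, Sigma phi -> fholds sval phi a.

(* Homogeneous coordinate vectors of the points of P^n(U). A subset of P^n is
   represented by the set of all coordinate vectors of its points; zero sets of
   Delta-homogeneous Delta-polynomials are invariant under rescaling. *)
Definition hvec (U : fieldType) (n : nat) := {x : 'rV[U]_n.+1 | x != 0}.

Definition hcoord (U : fieldType) (n : nat) (x : hvec U n) : 'I_n.+1 -> U :=
  fun i => sval x 0 i.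

Section Geometry.
Variables (m : nat) (F U : dfieldType m) (iota : F -> U).

Definition dzero (I : choiceType) (f : dpoly F I) (a : I -> U) :=
  dpeval iota (@der m U) a f = 0.

Definition dclosed n (X : set (hvec U n)) :=
  exists S : set (dpoly F 'I_n.+1),
    (forall f, S f -> exists d, dhomog predT d f)
    /\ X = [set x | forall f, S f -> dzero f (hcoord x)].

Definition dclosure n (X : set (hvec U n)) : set (hvec U n) :=
  [set x | forall C, dclosed C -> X `<=` C -> C x].

(* Closed subsets of P^n x P^k: zero sets of Delta-bihomogeneous
   Delta-polynomials in F{x_0..x_n, y_0..y_k}. *)
Definition dclosed2 n k (Z : set (hvec U n * hvec U k)) :=
  exists S : set (dpoly F ('I_n.+1 + 'I_k.+1)%type),
    (forall f, S f -> exists d e,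
       dhomog (fun i => if i is inl _ then true else false) d f
       /\ dhomog (fun i => if i is inr _ then true else false) e f)
    /\ Z = [set p | forall f, S f ->
         dzero f (fun i => match i with
                           | inl j => hcoord p.1 j
                           | inr j => hcoord p.2 j
                           end)].

Definition quasi_projective k (Y : set (hvec U k)) :=
  exists C D, dclosed C /\ dclosed D /\ Y = C `\` D.

(* The Delta-closed subsets of X x Y (resp. Y) are the traces on X x Y of those
   of P^n x P^k (resp. the traces on Y of those of P^k). *)
Definition dcomplete n (X : set (hvec U n)) :=
  dclosed X /\
  forall k (Y : set (hvec U k)), quasi_projective Y ->
  forall Z : set (hvec U n * hvec U k), dclosed2 Z ->
    exists2 W, dclosed W & snd @` (Z `&` (X `*` Y)) = Y `&` W.

(* The points [y : 1] of A^1 with delta_i y = P_i(y) for all i. *)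
Definition poly_flow (P : 'I_m -> {poly F}) : set (hvec U 1) :=
  [set p | hcoord p 1 != 0 /\
     let y := hcoord p 0 / hcoord p 1 in
     forall i, der i y - (map_poly iota (P i)).[y] = 0].

End Geometry.

(* Main.v *)
Require Import Defs.
From HB Require Import structures.
From mathcomp Require Import all_boot all_order all_algebra.
From mathcomp Require Import finmap monalg.
From mathcomp Require Import boolp classical_sets cardinality.
From mathcomp Require Import qfpoly.
From mathcomp Require Import ring zify.

(* Let [b] lie in the closure of the projection of [Z]. By saturation there are
   [x] in [V] and [a] with [(x, a)] in [Z] such that [a] specializes to [b] over
   [F]. If [x] is the point at infinity, it also works for [b]. Otherwise
   [x = c] solves [delta_i c = P_i(c)], so only polynomial relations between [c]
   and [A = F{a}] matter. Let [g] be a relation of [c] over [A] whose image [g^b]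
   under [a -> b] is non-zero of minimal degree; [g^b] divides all the images.
   - If there is no such [g], then [c] itself works for [b].
   - If [g^b] is not constant, an irreducible factor [p] of [g^b] divides its own
     derivatives, so that [U[X]/p] is a Delta-field, and as [U] is existentially
     closed it contains a solution [c'] with [p(c') = 0].
   - If [g^b] is constant, then [z = 1/c] is infinitesimal: some relation of [z]
     specializes to [u z^r], and none specializes to a non-zero constant. If
     some [P_i] has degree [d >= 2], the derivation [z^(d-2) delta_i] preserves
     the relations of [z] and maps [z] to a unit, which lowers [r] down to a
     contradiction. If all the degrees are at most one, every relation of [z]
     specializes to one that vanishes at [0], so the point at infinity lies in
     [V] and works for [b]. *)

Set Implicit Arguments.
Unset Strict Implicit.
Unset Printing Implicit Defensive.

Import GRing.Theory.
Local Open Scope ring_scope.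

(** * Derivations *)

Definition derivation (A : nzRingType) (d : A -> A) :=
  {morph d : x y / x + y} /\ forall x y, d (x * y) = d x * y + x * d y.

Section DerivationTheory.
Variables (A : nzRingType) (d : A -> A).
Hypothesis dd : derivation d.

Lemma derivation0 : d 0 = 0.
Proof. by apply: (addIr (d 0)); rewrite -dd.1 !add0r. Qed.

Lemma derivationN x : d (- x) = - d x.
Proof. by apply: (addIr (d x)); rewrite -dd.1 !addNr derivation0. Qed.

Lemma derivation1 : d 1 = 0.
Proof.
have := dd.2 1 1; rewrite !mulr1 mul1r => /eqP.
by rewrite -subr_eq subrr => /eqP.
Qed.

End DerivationTheory.

Lemma derivation_exp (A : comNzRingType) (d : A -> A) : derivation d ->
  forall x n, d (x ^+ n) = (x ^+ n.-1 * d x) *+ n.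
Proof.
move=> dd x; elim=> [|n IH]; first by rewrite expr0 (derivation1 dd) mulr0n.
rewrite exprS dd.2 IH; case: n {IH} => [|n] /=.
  by rewrite !expr0 mulr0n mulr0 addr0 mulr1 mul1r.
by rewrite -mulrnAr mulrA -exprS mulrnAr [d x * _]mulrC -mulrS.
Qed.

Lemma der_derivation m (K : dfieldType m) i : derivation (@der m K i).
Proof. by split; [exact: derD | exact: derM]. Qed.

Lemma der_inv m (K : dfieldType m) i (c : K) : c != 0 ->
  der i c^-1 = - (c^-1 ^+ 2 * der i c).
Proof.
move=> c0; have := derM i c c^-1.
rewrite divff // (derivation1 (der_derivation K i)) => /esym/eqP.
rewrite addrC addr_eq0 => /eqP E.
by rewrite -[LHS](mulKf c0) E; ring.
Qed.

Lemma commutator_derivation (A : comNzRingType) (d e : A -> A) :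
  derivation d -> derivation e -> derivation (fun x => d (e x) - e (d x)).
Proof.
by move=> dd de; split=> x y; rewrite !(dd.1, de.1, dd.2, de.2); ring.
Qed.

Lemma zero_derivation (A : nzRingType) : derivation (fun _ : A => 0).
Proof. by split=> x y; rewrite ?addr0 // mulr0 mul0r addr0. Qed.

(** * Differential polynomials *)

(* The ring operations that [monalg] puts on [dpoly K I] through different
   structures are convertible, but comparing them is prohibitively slow; the
   facts on derivations are therefore proved in an abstract ring [R]. *)
Section AbstractDPoly.
Variables (m : nat) (K : dfieldType m) (I : choiceType) (R : comNzRingType).
Implicit Types (v : dvar K I) (M N : {cmonom (dvar K I)}) (f g : R).
Variables (cst : {rmorphism K -> R}) (mon : {cmonom (dvar K I)} -> R).
Variables (supp : R -> {fset {cmonom (dvar K I)}}).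
Variables (coef : {cmonom (dvar K I)} -> R -> K).
Variables (mder : 'I_m -> {cmonom (dvar K I)} -> R) (rder : 'I_m -> R -> R).
Hypothesis mon1 : mon (onecm _) = 1.
Hypothesis monM : forall M N, mon (mulcm M N) = mon M * mon N.
Hypothesis mder_sum : forall i M (S : {fset dvar K I}), (finsupp M `<=` S)%fset ->
  mder i M = \sum_(v <- S)
    cst (M v)%:R * (mon (divcm M (ucm v)) * mon (ucm (dvar_der i v))).
Hypothesis coefD : forall M f g, coef M (f + g) = coef M f + coef M g.
Hypothesis suppD : forall f g, (supp (f + g) `<=` supp f `|` supp g)%fset.
Hypothesis expand : forall f, f = \sum_(M <- supp f) cst (coef M f) * mon M.
Hypothesis rder_sum : forall i f (S : {fset {cmonom (dvar K I)}}),
  (supp f `<=` S)%fset -> rder i f = \sum_(M <- S)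
    (cst (der i (coef M f)) * mon M + cst (coef M f) * mder i M).
Hypothesis rderU : forall i c M,
  rder i (cst c * mon M) = cst (der i c) * mon M + cst c * mder i M.

Lemma mderM i M N : mder i (mulcm M N) = mder i M * mon N + mon M * mder i N.
Proof.
pose S := (finsupp M `|` finsupp N)%fset.
rewrite (@mder_sum i M S) ?fsubsetUl // (@mder_sum i N S) ?fsubsetUr //.
rewrite (@mder_sum i _ S); last by rewrite (mdomD M N).
rewrite mulr_suml mulr_sumr -big_split; apply: eq_bigr => v _.
rewrite mulcmE natrD rmorphD mulrDl; congr (_ + _).
  (* [divcm] subtracts exponents with truncation at zero, so the two monomials agree only if [v]
     occurs in [M]; otherwise the coefficient kills the term. *)
  have [->|Mv] := eqVneq (M v) 0%N; first by rewrite !rmorph0 !mul0r.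
  rewrite -!mulrA; congr (_ * _); rewrite [RHS]mulrCA [RHS]mulrC -[X in _ = X * _]monM.
  congr (mon _ * _); apply/eqP/cmP => w; rewrite !(mulcmE, divcmE, ucmE).
  by case: eqVneq => [<-|_]; rewrite ?subn0; move: Mv; rewrite -?lt0n; lia.
have [->|Nv] := eqVneq (N v) 0%N; first by rewrite !rmorph0 !mul0r mulr0.
rewrite [RHS]mulrCA; congr (_ * _); rewrite mulrA -[X in _ = X * _]monM; congr (mon _ * _).
apply/eqP/cmP => w; rewrite !(mulcmE, divcmE, ucmE).
by case: eqVneq => [<-|_]; rewrite ?subn0; move: Nv; rewrite -?lt0n; lia.
Qed.

Lemma rderD i : {morph rder i : f g / f + g}.
Proof.
move=> f g; pose S := (supp f `|` supp g)%fset.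
rewrite (@rder_sum i f S) ?fsubsetUl // (@rder_sum i g S) ?fsubsetUr //.
rewrite (@rder_sum i _ S) ?suppD // -big_split; apply: eq_bigr => M _.
by rewrite coefD derD !rmorphD !mulrDl /=; ring.
Qed.

Lemma rder_derivation i : derivation (rder i).
Proof.
split=> [|f g]; first exact: rderD.
have rder0 : rder i 0 = 0 by apply: (addIr (rder i 0)); rewrite -rderD !add0r.
pose dsum := big_morph _ (@rderD i) rder0.
rewrite (expand f) (expand g).
rewrite !dsum !mulr_suml !dsum -big_split; apply: eq_bigr => M _.
rewrite !mulr_sumr !dsum -big_split; apply: eq_bigr => N _.
move: (coef M f) (coef N g) => c e.
have -> : cst c * mon M * (cst e * mon N) = cst (c * e) * mon (mulcm M N).
  by rewrite monM rmorphM; ring.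
rewrite !rderU mderM monM derM !(rmorphD, rmorphM) /=; ring.
Qed.

Lemma divcmK M v : v \in finsupp M -> mulcm (ucm v) (divcm M (ucm v)) = M.
Proof.
move=> vM; apply/eqP/cmP => w; rewrite mulcmE divcmE ucmE.
case: eqVneq => [<-|_]; last by rewrite subn0.
by rewrite subnKC // lt0n cmE_neq0.
Qed.

Lemma alg_ind (Q : R -> Prop) :
  (forall c, Q (cst c)) -> (forall v, Q (mon (ucm v))) ->
  (forall f g, Q f -> Q g -> Q (f + g)) ->
  (forall f g, Q f -> Q g -> Q (f * g)) -> forall f, Q f.
Proof.
move=> QC QV QD QM f; rewrite (expand f).
elim/big_rec: _ => [|M g _ Qg]; first by rewrite -(rmorph0 cst); apply: QC.
apply: (QD) => //; apply: (QM) => // {g Qg}.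
have [n] := ubnP (mdeg M); elim: n M => // n IH M ltMn.
have [/eqP|] := boolP (finsupp M == fset0).
  move=> M0; have -> : M = onecm _; last by rewrite mon1 -(rmorph1 cst); apply: QC.
  by apply/eqP/cmP => v; rewrite onecmE; apply/eqP; rewrite cmE_eq0 M0 inE.
move/fset0Pn => [v vM].
rewrite -(divcmK vM) monM; apply: (QM); first exact: (QV v).
apply: IH.
suff E : mdeg M = (1 + mdeg (divcm M (ucm v)))%N by rewrite E in ltMn.
rewrite -{1}(divcmK vM); apply: etrans (mdegM (ucm v) _) _.
by rewrite mdegU.
Qed.

Lemma alg_derivation_ext (D E : R -> R) : derivation D -> derivation E ->
  (forall c, D (cst c) = E (cst c)) ->
  (forall v, D (mon (ucm v)) = E (mon (ucm v))) -> D =1 E.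
Proof.
move=> [DD DM] [ED EM] eqC eqV; apply: alg_ind => // f g Df Dg.
  by rewrite DD ED Df Dg.
by rewrite DM EM Df Dg.
Qed.

Lemma rder_cst i c : rder i (cst c) = cst (der i c).
Proof.
have := rderU i c (onecm _); rewrite mon1 !mulr1 => ->.
rewrite (@mder_sum i _ fset0) ?big_seq_fset0 ?mulr0 ?addr0 //.
by rewrite mdom1 fsub0set.
Qed.

Lemma rder_var i v : rder i (mon (ucm v)) = mon (ucm (dvar_der i v)).
Proof.
have := rderU i 1 (ucm v); rewrite rmorph1 !mul1r => ->.
rewrite (derivation1 (der_derivation K i)) rmorph0 mul0r add0r.
rewrite (@mder_sum i _ [fset v]%fset); last by rewrite mdomU.
rewrite big_seq_fset1 ucmE eqxx rmorph1 mul1r.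
suff -> : divcm (ucm v) (ucm v) = onecm _ by rewrite mon1 mul1r.
by apply/eqP/cmP => w; rewrite divcmE subnn onecmE.
Qed.

Lemma dvar_derC i j v : dvar_der i (dvar_der j v) = dvar_der j (dvar_der i v).
Proof. by congr (_, _); apply/ffunP => k; rewrite !ffunE addnAC. Qed.

(** The commutator of two derivations is again a derivation, and this one vanishes on constants and
    on variables. *)
Lemma rder_comm i j f : rder i (rder j f) = rder j (rder i f).
Proof.
apply/eqP; rewrite -subr_eq0; apply/eqP.
apply: (alg_derivation_ext
  (commutator_derivation (rder_derivation i) (rder_derivation j))
  (zero_derivation R)) => [c|v].
  by rewrite !rder_cst derC subrr.
by rewrite !rder_var dvar_derC subrr.
Qed.

End AbstractDPoly.

(** * The monoid algebra as a differential ring *)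

Section DPolyRing.
Variables (m : nat) (K : dfieldType m) (I : choiceType).
Implicit Types (v : dvar K I) (M N : {cmonom (dvar K I)}).

Definition dpring : comNzRingType := dpoly K I.

Definition dcst (c : K) : dpring := c%:MP.
Definition dmon M : dpring := << M >>.
Definition dpvar v : dpring := dmon (ucm v).
Definition dder (i : 'I_m) (f : dpring) : dpring := dpder i f.
Definition dmonder (i : 'I_m) M : dpring := dmon_der i M.

Fact dcst_is_additive : additive dcst.
Proof. exact: monalgU_is_additive. Qed.
Fact dcst_is_monoid_morphism : monoid_morphism dcst.
Proof. by have [HM H1] := malgC_is_multiplicative {cmonom (dvar K I)} K; split. Qed.
HB.instance Definition _ := GRing.isZmodMorphism.Build K dpring dcst dcst_is_additive.
HB.instance Definition _ := GRing.isMonoidMorphism.Build K dpring dcst dcst_is_monoid_morphism.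

Lemma dmonM M N : dmon (mulcm M N) = dmon M * dmon N.
Proof.
apply/esym/(etrans (malgM_def _ _))/(etrans (fgmulUU _ _ _ _)).
by rewrite mulr1.
Qed.

Lemma dmonE c M : << c *g M >> = dcst c * dmon M :> dpring.
Proof.
apply/esym/(etrans (malgM_def _ _))/(etrans (fgmulUU _ _ _ _)).
by rewrite mulr1 mul1m.
Qed.

Lemma dscaleE c (f : dpring) : c *: (f : dpoly K I) = dcst c * f.
Proof. exact/esym/mul_malgC. Qed.

Lemma dpolyE (f : dpring) :
  f = \sum_(M <- msupp (f : dpoly K I)) dcst (f : dpoly K I)@_M * dmon M.
Proof.
rewrite {1}[f](monalgE (f : dpoly K I)) /=.
by apply: eq_bigr => M _; apply: dmonE.
Qed.

Lemma dmon1 : dmon (onecm _) = 1.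
Proof. by []. Qed.

Lemma dmonderE i M (S : {fset dvar K I}) : (finsupp M `<=` S)%fset ->
  dmonder i M = \sum_(v <- S)
    dcst (M v)%:R * (dmon (divcm M (ucm v)) * dpvar (dvar_der i v)).
Proof.
move=> sMS; rewrite -[RHS](big_fset_incl _ sMS) => [|v _ vM].
  apply: (big_ind2 (fun x y : dpring => x = y)) => [|x1 x2 y1 y2 -> ->|v _] //.
  by apply: etrans (dscaleE _ _) _; congr (_ * _); exact: dmonM.
by move: vM; rewrite -cmE_eq0 => /eqP ->; rewrite rmorph0 mul0r.
Qed.

Lemma dderE i (f : dpring) (S : {fset {cmonom (dvar K I)}}) :
  (msupp (f : dpoly K I) `<=` S)%fset ->
  dder i f = \sum_(M <- S) (dcst (der i (f : dpoly K I)@_M) * dmon M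
                            + dcst (f : dpoly K I)@_M * dmonder i M).
Proof.
move=> sfS; rewrite -[RHS](big_fset_incl _ sfS) => [|M _ Mf].
  apply: (big_ind2 (fun x y : dpring => x = y)) => [|x1 x2 y1 y2 -> ->|M _] //.
  exact: (congr2 (@GRing.add dpring) (dmonE _ _) (dscaleE _ (dmonder i M))).
rewrite mcoeff_outdom // (derivation0 (der_derivation K i)).
by rewrite !rmorph0 !mul0r addr0.
Qed.

Lemma dderU i c M :
  dder i (dcst c * dmon M) = dcst (der i c) * dmon M + dcst c * dmonder i M.
Proof.
have := @dderE i << c *g M >> [fset M]%fset msuppU_le.
rewrite big_seq_fset1 mcoeffUU => <-.
by apply: congr1; exact/esym/dmonE.
Qed.

Lemma dder_derivation i : derivation (dder i).
Proof.
exact: (rder_derivation dmonM dmonderE (@mcoeffD _ _) (@msuppD_le _ _)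
  dpolyE dderE dderU).
Qed.

Lemma dpoly_alg_ind (Q : dpring -> Prop) :
  (forall c, Q (dcst c)) -> (forall v, Q (dpvar v)) ->
  (forall f g, Q f -> Q g -> Q (f + g)) ->
  (forall f g, Q f -> Q g -> Q (f * g)) -> forall f, Q f.
Proof. exact: (alg_ind dmon1 dmonM dpolyE). Qed.

Lemma dder_cst i c : dder i (dcst c) = dcst (der i c).
Proof. exact: (rder_cst dmon1 dmonderE dderU). Qed.

Lemma dder_var i v : dder i (dpvar v) = dpvar (dvar_der i v).
Proof. exact: (rder_var dmon1 dmonderE dderU). Qed.

Lemma dder_comm i j f : dder i (dder j f) = dder j (dder i f).
Proof.
exact: (rder_comm dmon1 dmonM dmonderE (@mcoeffD _ _) (@msuppD_le _ _)
  dpolyE dderE dderU).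
Qed.

End DPolyRing.

Lemma iter_comm (A : Type) (f g : A -> A) : (forall x, f (g x) = g (f x)) ->
  forall n x, iter n f (g x) = g (iter n f x).
Proof. by move=> fg; elim=> //= n IH x; rewrite IH fg. Qed.

(** The extra [d i] is moved outwards past the other operators by commutativity. In the induction
    over a duplicate-free list [s] it is present exactly when [i] belongs to [s]. *)
Lemma theta_succ m (A : Type) (d : 'I_m -> A -> A) :
    (forall i j x, d i (d j x) = d j (d i x)) ->
  forall (i : 'I_m) (alpha : {ffun 'I_m -> nat}) x,
    theta d [ffun j => (alpha j + (j == i))%N] x = d i (theta d alpha x).
Proof.
move=> dC i alpha x; rewrite /theta.
set f := fun j y => _; set g := fun j y => _.
suff E s : uniq s ->
    foldr f x s = if i \in s then d i (foldr g x s) else foldr g x s.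
  by rewrite E ?enum_uniq // mem_enum.
elim: s => //= j s IH /andP[js us]; rewrite IH // inE /f /g ffunE.
case: eqVneq => [ij|ji] /=.
  by subst j; rewrite (negPf js) addn1 iterS.
rewrite addn0; case: ifP => // _.
by rewrite (iter_comm (dC j i)).
Qed.

(** * Differential induction *)

Section AbstractDiffInd.
Variables (m : nat) (K : dfieldType m) (I : choiceType) (R : comNzRingType).
Variables (cst : K -> R) (var : dvar K I -> R) (rder : 'I_m -> R -> R).
Hypothesis ind : forall Q : R -> Prop,
  (forall c, Q (cst c)) -> (forall v, Q (var v)) ->
  (forall f g, Q f -> Q g -> Q (f + g)) ->
  (forall f g, Q f -> Q g -> Q (f * g)) -> forall f, Q f.
Hypothesis rder_derivation : forall i, derivation (rder i).
Hypothesis rder_cst : forall i c, rder i (cst c) = cst (der i c).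
Hypothesis rder_var : forall i v, rder i (var v) = var (dvar_der i v).
Let X i := var (i, [ffun=> 0%N]).

Lemma morph_rder (A : comNzRingType) (h : K -> A) (d : 'I_m -> A -> A)
    (a : I -> A) (e : {rmorphism R -> A}) :
    (forall i, derivation (d i)) ->
    (forall i j x, d i (d j x) = d j (d i x)) ->
    (forall i c, h (der i c) = d i (h c)) ->
    (forall c, e (cst c) = h c) ->
    (forall v, e (var v) = theta d v.2 (a v.1)) ->
  forall i f, e (rder i f) = d i (e f).
Proof.
move=> dd dC hd ec evar i; apply: ind => [c|v|f g Ef Eg|f g Ef Eg].
- by rewrite rder_cst !ec hd.
- by rewrite rder_var !evar -(theta_succ dC).
- by rewrite (rder_derivation i).1 !rmorphD /= Ef Eg (dd i).1.
- by rewrite (rder_derivation i).2 rmorphD !rmorphM /= Ef Eg (dd i).2.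
Qed.

(** Every algebraic indeterminate is an iterated derivative of one of order zero, which turns
    algebraic induction into the differential induction [diff_ind]. *)
Lemma theta_var alpha i : theta rder alpha (X i) = var (i, alpha).
Proof.
have iterE j n (beta : {ffun 'I_m -> nat}) : iter n (rder j) (var (i, beta)) =
    var (i, [ffun k => (beta k + n * (k == j))%N]).
  elim: n => [|n IH] /=.
    by congr var; congr (_, _); apply/ffunP => k; rewrite ffunE addn0.
  rewrite IH rder_var; congr var; congr (_, _); apply/ffunP => k.
  by rewrite !ffunE /=; lia.
suff E s : uniq s -> foldr (fun j y => iter (alpha j) (rder j) y) (X i) s =
    var (i, [ffun j => if j \in s then alpha j else 0%N]).
  rewrite /theta E ?enum_uniq //; congr var; congr (_, _).
  by apply/ffunP => j; rewrite ffunE mem_enum.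
elim: s => [_|j s IH /= /andP[js us]] /=.
  by congr var; congr (_, _); apply/ffunP => k; rewrite !ffunE.
rewrite IH // iterE; congr var; congr (_, _); apply/ffunP => k.
rewrite !ffunE inE; case: eqVneq => [->|_] /=; last by rewrite muln0 addn0.
by rewrite (negPf js) muln1.
Qed.

Lemma diff_ind (Q : R -> Prop) :
  (forall c, Q (cst c)) -> (forall i, Q (X i)) ->
  (forall f g, Q f -> Q g -> Q (f + g)) ->
  (forall f g, Q f -> Q g -> Q (f * g)) ->
  (forall i f, Q f -> Q (rder i f)) -> forall f, Q f.
Proof.
move=> QC QX QD QM Qd; apply: ind => // -[i alpha].
rewrite -theta_var /theta; elim: (enum _) => //= j s IH.
by elim: (alpha j) => //= n; apply: Qd.
Qed.

End AbstractDiffInd.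

(** * Evaluation of differential polynomials *)

Section Evaluation.
Variables (m : nat) (K : dfieldType m) (I : choiceType) (A : comNzRingType).
Variables (h : {rmorphism K -> A}) (d : 'I_m -> A -> A) (a : I -> A).
Implicit Types (v : dvar K I) (M N : {cmonom (dvar K I)}).

Definition evmon (M : {cmonom (dvar K I)}) : A :=
  \prod_(v <- finsupp M) theta d v.2 (a v.1) ^+ M v.

Lemma evmonE M (S : {fset dvar K I}) : (finsupp M `<=` S)%fset ->
  evmon M = \prod_(v <- S) theta d v.2 (a v.1) ^+ M v.
Proof.
move=> sMS; rewrite /evmon (big_fset_incl _ sMS) // => v _ vM.
by move: vM; rewrite -cmE_eq0 => /eqP ->; rewrite expr0.
Qed.

Lemma evmonM M N : evmon (mulcm M N) = evmon M * evmon N.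
Proof.
pose S := (finsupp M `|` finsupp N)%fset.
rewrite (@evmonE M S) ?fsubsetUl // (@evmonE N S) ?fsubsetUr //.
rewrite (@evmonE _ S); last by rewrite (mdomD M N).
by rewrite -big_split; apply: eq_bigr => v _; rewrite mulcmE exprD.
Qed.

Lemma evmon_mmorphism : mmorphism evmon.
Proof. by split; [exact: evmonM | rewrite /evmon mdom1 big_seq_fset0]. Qed.

HB.instance Definition _ :=
  isMultiplicative.Build {cmonom (dvar K I)} A evmon evmon_mmorphism.

Definition ev (f : dpring K I) : A := dpeval h d a f.

Fact ev_is_zmod_morphism : zmod_morphism ev.
Proof. exact: (@mmap_is_additive _ _ _ h evmon). Qed.

Fact ev_is_monoid_morphism : monoid_morphism ev.
Proof.
have [H1 H2] := @mmap_is_multiplicative _ _ _ h evmon.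
by split.
Qed.

HB.instance Definition _ :=
  GRing.isZmodMorphism.Build (dpring K I) A ev ev_is_zmod_morphism.
HB.instance Definition _ :=
  GRing.isMonoidMorphism.Build (dpring K I) A ev ev_is_monoid_morphism.

Lemma ev_cst c : ev (dcst I c) = h c.
Proof. exact: (@mmapC _ _ _ h evmon). Qed.

Lemma ev_var v : ev (dpvar v) = theta d v.2 (a v.1).
Proof.
apply: (etrans (@mmapU _ _ _ h evmon _ _)).
by rewrite [X in X * _](rmorph1 h) mul1r /evmon mdomU big_seq_fset1 ucmE eqxx.
Qed.

End Evaluation.

(* The structure of [dpoly K I] as a differential algebra. Its instance is opaque,
   which keeps unification away from the ring operations of [monalg]. *)
Record diffpoly_ring (m : nat) (K : dfieldType m) (I : choiceType) :=
  DiffPolyRing {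
  dp :> comNzRingType;
  dp_of : {rmorphism dpring K I -> dp};
  of_dp : dp -> dpring K I;
  dp_ofK : cancel dp_of of_dp;
  of_dpK : cancel of_dp dp_of;
  cst : {rmorphism K -> dp};
  cstE : forall c, dp_of (c%:MP) = cst c;
  X : I -> dp;
  XE : forall i, dp_of (dpX K i) = X i;
  ddp : 'I_m -> dp -> dp;
  ddpE : forall i f, dp_of (dpder i f) = ddp i (dp_of f);
  ddp_derivation : forall i, derivation (ddp i);
  ddpC : forall i j f, ddp i (ddp j f) = ddp j (ddp i f);
  ddp_cst : forall i c, ddp i (cst c) = cst (der i c);
  dp_ind : forall Q : dp -> Prop,
    (forall c, Q (cst c)) -> (forall i, Q (X i)) ->
    (forall f g, Q f -> Q g -> Q (f + g)) ->
    (forall f g, Q f -> Q g -> Q (f * g)) ->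
    (forall i f, Q f -> Q (ddp i f)) -> forall f, Q f;
  evd : forall (A : comNzRingType), {rmorphism K -> A} ->
    ('I_m -> A -> A) -> (I -> A) -> {rmorphism dp -> A};
  evdE : forall (A : comNzRingType) (h : {rmorphism K -> A}) d a f,
    evd h d a (dp_of f) = dpeval h d a f;
  evd_cst : forall (A : comNzRingType) (h : {rmorphism K -> A}) d a c,
    evd h d a (cst c) = h c;
  evd_X : forall (A : comNzRingType) (h : {rmorphism K -> A}) d a i,
    evd h d a (X i) = a i;
  evd_der : forall (A : comNzRingType) (h : {rmorphism K -> A}) d a,
    (forall i, derivation (d i)) ->
    (forall i j x, d i (d j x) = d j (d i x)) ->
    (forall i c, h (der i c) = d i (h c)) ->
    forall i f, evd h d a (ddp i f) = d i (evd h d a f)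
}.

Definition diffpoly m (K : dfieldType m) (I : choiceType) : diffpoly_ring K I.
Proof.
apply: (@DiffPolyRing m K I (dpring K I) idfun idfun _ _ (@dcst m K I) _
  (fun i => dpX K i) _ (@dder m K I) _ _ _ _ _ (fun A h d a => ev h d a)).
- by [].
- by [].
- by [].
- by [].
- by [].
- exact: dder_derivation.
- exact: dder_comm.
- exact: dder_cst.
- exact: (diff_ind (@dpoly_alg_ind m K I) (@dder_var m K I)).
- by [].
- by move=> A h d a c; exact: ev_cst.
- move=> A h d a i; apply: (etrans (ev_var h d a _)).
  by rewrite /theta /=; elim: (enum _) => //= j s ->; rewrite ffunE.
- move=> A h d a dd dC hd.
  exact: (morph_rder (@dpoly_alg_ind m K I) (@dder_derivation m K I)
    (@dder_cst m K I) (@dder_var m K I) dd dC hd (ev_cst h d a) (ev_var h d a)).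
Qed.

Lemma dpeval_morph m (K : dfieldType m) (I : choiceType) (A B : comNzRingType)
    (phi : {rmorphism A -> B}) (h : K -> A) (h' : K -> B) d d' (a : I -> A) f :
    (forall c, phi (h c) = h' c) ->
    (forall i x, phi (d i x) = d' i (phi x)) ->
  phi (dpeval h d a f) = dpeval h' d' (fun i => phi (a i)) f.
Proof.
move=> hh dd; rewrite /dpeval /mmap rmorph_sum; apply: eq_bigr => M _.
rewrite rmorphM hh rmorph_prod; congr (_ * _); apply: eq_bigr => v _.
rewrite rmorphXn; congr (_ ^+ _); rewrite /theta.
elim: (enum _) => //= i s <-; elim: (v.2 i) => //= n <-.
by rewrite dd.
Qed.

Lemma evd_morph m (K : dfieldType m) (I : choiceType) (A B : comNzRingType)
    (phi : {rmorphism A -> B}) (h : {rmorphism K -> A}) (h' : {rmorphism K -> B})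
    d d' (a : I -> A) (f : diffpoly K I) :
    (forall c, phi (h c) = h' c) ->
    (forall i x, phi (d i x) = d' i (phi x)) ->
  phi (evd (diffpoly K I) h d a f) = evd (diffpoly K I) h' d' (fun i => phi (a i)) f.
Proof. by move=> hh dd; rewrite -(of_dpK f) !evdE; exact: dpeval_morph. Qed.

Lemma eq_evd m (K : dfieldType m) (I : choiceType) (A : comNzRingType)
    (h : {rmorphism K -> A}) d (a b : I -> A) (f : diffpoly K I) : a =1 b ->
  evd (diffpoly K I) h d a f = evd (diffpoly K I) h d b f.
Proof. by move=> /funext ->. Qed.

(** * Homogeneity *)

Section Homogeneous.
Variables (m : nat) (K : dfieldType m) (I : choiceType).
Implicit Types (B : pred I) (d e : nat) (f g : diffpoly K I).

Let T := diffpoly K (option I).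
(** [generic] and [dilated] are the two substitutions in the identity that defines [dhomog]; the
    dilation parameter is [X T None]. *)
Definition generic : diffpoly K I -> T :=
  evd (diffpoly K I) (cst T) (@ddp _ _ _ T) (fun i => X T (Some i)).
Definition dilated B : diffpoly K I -> T :=
  evd (diffpoly K I) (cst T) (@ddp _ _ _ T)
    (fun i => if B i then X T None * X T (Some i) else X T (Some i)).

Definition homogeneous B d f := dilated B f = X T None ^+ d * generic f.

Lemma dhomogE B d (f : dpoly K I) :
  dhomog B d f <-> homogeneous B d (dp_of (diffpoly K I) f).
Proof.
have E a : dp_of T (dpeval (fun c : K => c%:MP) (@dpder m K (option I)) a f)
    = evd (diffpoly K I) (cst T) (@ddp _ _ _ T) (fun i => dp_of T (a i))
        (dp_of (diffpoly K I) f).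
  rewrite evdE; apply: dpeval_morph; [exact: cstE | exact: ddpE].
pose t : dpring K (option I) := dpX K None.
pose x i : dpring K (option I) := dpX K (Some i).
have EL : dilated B (dp_of (diffpoly K I) f) =
    dp_of T (dpeval (fun c : K => c%:MP) (@dpder m K (option I))
      (fun i => if B i then t * x i else x i) f).
  apply: (etrans _ (esym (E _))); apply: eq_evd => i.
  case: (B i); last exact/esym/XE.
  apply/esym/(etrans (rmorphM (dp_of T) _ _)).
  exact: (congr2 *%R (XE T None) (XE T (Some i))).
have ER : X T None ^+ d * generic (dp_of (diffpoly K I) f) =
    dp_of T (t ^+ d * (dpeval (fun c : K => c%:MP) (@dpder m K (option I)) x f
                       : dpring K (option I))).
  apply/esym/(etrans (rmorphM (dp_of T) _ _))/congr2.
    apply: (etrans (rmorphXn (dp_of T) _ _)).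
    exact: (congr1 (fun y => y ^+ d) (XE T None)).
  by apply: (etrans (E _)); apply: eq_evd => i; exact: XE.
rewrite /homogeneous EL ER.
split=> [H|]; first exact: (congr1 (dp_of T) H).
by move/(can_inj (@dp_ofK _ _ _ T)).
Qed.

(** Homogeneity is an identity in the differential polynomial ring with the extra indeterminate [t],
    so it can be evaluated at any [t] and [x], even at a non-constant [t]. *)
Lemma homogeneous_ev B d f (L : dfieldType m) (h : {rmorphism K -> L}) :
  dmorphism h -> homogeneous B d f -> forall (t : L) (x : I -> L),
  evd (diffpoly K I) h (@der m L) (fun i => if B i then t * x i else x i) f =
  t ^+ d * evd (diffpoly K I) h (@der m L) x f.
Proof.
move=> hd Hf t x.
pose phi := evd T h (@der m L) (fun i => if i is Some i then x i else t).
have phi_cst c : phi (cst T c) = h c by rewrite /phi evd_cst.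
have phi_d i y : phi (ddp i y) = der i (phi y).
  by apply: evd_der; [exact: der_derivation | exact: derC | exact: hd].
transitivity (phi (dilated B f)).
  rewrite /dilated (evd_morph _ _ phi_cst phi_d); apply: eq_evd => i.
  by case: (B i); rewrite ?rmorphM /phi !evd_X.
rewrite Hf rmorphM rmorphXn /generic (evd_morph _ _ phi_cst phi_d).
congr (_ ^+ _ * _); first by rewrite /phi evd_X.
by apply: eq_evd => i; rewrite /phi evd_X.
Qed.

Lemma homogeneousD B d f g :
  homogeneous B d f -> homogeneous B d g -> homogeneous B d (f + g).
Proof.
by rewrite /homogeneous /dilated /generic => Hf Hg; rewrite !rmorphD mulrDr Hf Hg.
Qed.

Lemma homogeneousM B d e f g :
  homogeneous B d f -> homogeneous B e g -> homogeneous B (d + e) (f * g).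
Proof.
rewrite /homogeneous /dilated /generic => Hf Hg.
by rewrite !rmorphM /= Hf Hg exprD; ring.
Qed.

Lemma homogeneous_cst B c : homogeneous B 0 (cst (diffpoly K I) c).
Proof. by rewrite /homogeneous /dilated /generic !evd_cst mul1r. Qed.

Lemma homogeneousX (B : pred I) i : B i -> homogeneous B 1 (X (diffpoly K I) i).
Proof. by rewrite /homogeneous /dilated /generic !evd_X expr1 => ->. Qed.

Lemma homogeneousXn (B : pred I) i n :
  B i -> homogeneous B n (X (diffpoly K I) i ^+ n).
Proof.
move=> Bi; elim: n => [|n IH].
  by rewrite expr0 -(rmorph1 (cst (diffpoly K I))); exact: homogeneous_cst.
by rewrite exprS -add1n; apply: homogeneousM => //; exact: homogeneousX.
Qed.

(** The derivative of [f] alone is not homogeneous, since differentiating [t ^+ d] produces a term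
    in the derivative of [t]. The combination is [x_j^(d+1)] times the derivative of [f / x_j^d], in
    which such terms cancel. *)
Lemma homogeneous_der (B : pred I) d f i j : B j -> homogeneous B d f ->
  homogeneous B d.+1 (X (diffpoly K I) j * ddp i f
                      - ddp i (X (diffpoly K I) j) * f *+ d).
Proof.
have evC a k g : evd (diffpoly K I) (cst T) (@ddp _ _ _ T) a (ddp k g)
    = ddp k (evd (diffpoly K I) (cst T) (@ddp _ _ _ T) a g).
  apply: evd_der => *; [exact: ddp_derivation|exact: ddpC|by rewrite ddp_cst].
move=> Bj; rewrite /homogeneous /dilated /generic => Hf.
rewrite !rmorphB !rmorphMn !rmorphM !evC !evd_X Bj /= Hf.
have dD := ddp_derivation T i.
rewrite !dD.2 (derivation_exp dD).
move: (evd _ _ _ _ f) (X T None) (X T (Some j)) => G t x.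
move: (ddp i G) (ddp i t) (ddp i x) => G' t' x'.
case: d {Hf} => [|d]; first by rewrite !mulr0n; ring.
by rewrite /= !exprS; ring.
Qed.

(** Induction on [f]: the degrees of summands are equalized by powers of [X j], and derivatives are
    handled by [homogeneous_der], whose correction term vanishes at [x j = 1] because [1] is a
    constant. *)
Lemma homogenize (L : dfieldType m) (h : {rmorphism K -> L}) (j : I) :
  dmorphism h -> forall f, exists d g, homogeneous predT d g /\
  forall x : I -> L, x j = 1 ->
    evd (diffpoly K I) h (@der m L) x g = evd (diffpoly K I) h (@der m L) x f.
Proof.
move=> hd; have evC x k g : evd (diffpoly K I) h (@der m L) x (ddp k g)
    = der k (evd (diffpoly K I) h (@der m L) x g).
  by apply: evd_der; [exact: der_derivation | exact: derC | exact: hd].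
apply: dp_ind => [c|i|f g [d [f' [Hf Ef]]] [e [g' [Hg Eg]]]
    |f g [d [f' [Hf Ef]]] [e [g' [Hg Eg]]]|i f [d [f' [Hf Ef]]]].
- by exists 0%N, (cst _ c); split=> //; exact: homogeneous_cst.
- by exists 1%N, (X _ i); split=> //; exact: homogeneousX.
- exists (d + e)%N, (f' * X _ j ^+ e + g' * X _ j ^+ d); split.
    apply: homogeneousD; first by apply: homogeneousM => //; exact: homogeneousXn.
    by rewrite addnC; apply: homogeneousM => //; exact: homogeneousXn.
  move=> x xj; rewrite !rmorphD !rmorphM !rmorphXn !evd_X xj !expr1n !mulr1.
  by rewrite Ef // Eg.
- exists (d + e)%N, (f' * g'); split; first exact: homogeneousM.
  by move=> x xj; rewrite !rmorphM /= Ef // Eg.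
- exists d.+1, (X _ j * ddp i f' - ddp i (X _ j) * f' *+ d); split.
    exact: homogeneous_der.
  move=> x xj; rewrite rmorphB rmorphMn !rmorphM !evC !evd_X xj.
  by rewrite (derivation1 (der_derivation L i)) mul0r mul0rn subr0 mul1r Ef.
Qed.

End Homogeneous.

(** * Invariant irreducible factors and solutions in U *)

Section IrreducibleFactors.
Variable U : fieldType.
Implicit Types (p g h : {poly U}).

Lemma irreducible_factor g : (1 < size g)%N ->
  exists2 p, irreducible_poly p & p %| g.
Proof.
have [n] := ubnP (size g); elim: n g => // n IH g ltgn g1.
have [g_irr|] := EM (irreducible_poly g); first by exists g.
move=> /not_andP[//|/existsNP[p /not_implyP[p1 /not_implyP[pg /negP npg]]]].
have g0 : g != 0 by rewrite -size_poly_gt0 ltnW.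
have ltpg : (size p < size g)%N.
  by rewrite ltn_neqAle dvdp_size_eqp // npg dvdp_leq.
have p1' : (1 < size p)%N.
  rewrite ltn_neqAle eq_sym p1 size_poly_gt0.
  by apply: contraTneq pg => ->; rewrite dvd0p.
have [q q_irr qp] := IH p (leq_trans ltpg ltgn) p1'.
by exists q => //; exact: dvdp_trans qp pg.
Qed.

Lemma irreducible_multiplicity p g : irreducible_poly p -> g != 0 ->
  exists n h, g = p ^+ n * h /\ ~~ (p %| h).
Proof.
move=> [p1 _]; have [n] := ubnP (size g); elim: n g => // n IH g ltgn g0.
have [pg|npg] := boolP (p %| g); last by exists 0%N, g; rewrite expr0 mul1r.
move: (pg) => /dvdpP[h gE].
have h0 : h != 0 by apply: contraNneq g0 => h0; rewrite gE h0 mul0r.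
have p0 : p != 0 by rewrite -size_poly_gt0 ltnW.
have lthg : (size h < size g)%N.
  have := h0; rewrite gE size_mul // -size_poly_gt0.
  by move: (size h) (size p) p1 => a b; lia.
have [k [h' [hE nph']]] := IH h (leq_trans lthg ltgn) h0.
by exists k.+1, h'; split=> //; rewrite gE hE exprSr; ring.
Qed.

Lemma irreducible_dvdM p g h : irreducible_poly p -> ~~ (p %| h) ->
  p %| g * h -> p %| g.
Proof.
move=> p_irr nph; rewrite Gauss_dvdpl //.
by rewrite irreducible_poly_coprime.
Qed.

(** With [g = p^(n+1) h] and [p] prime to [h], the Leibniz rule gives [D g = (n+1) p^n (D p) h]
    modulo [p^(n+1)]. In characteristic zero [n+1] is invertible, so [p] divides [(D p) h], hence
    [D p]. *)
Lemma irreducible_dvd_derivation (D : {poly U} -> {poly U}) p g :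
    [pchar U] =i pred0 -> derivation D -> irreducible_poly p -> g != 0 ->
  p %| g -> g %| D g -> p %| D p.
Proof.
move=> U0 dD p_irr g0 pg gDg.
have [[|n] [h [gE nph]]] := irreducible_multiplicity p_irr g0.
  by move: pg; rewrite gE expr0 mul1r (negPf nph).
have p0 : p != 0 by case: p_irr => p1 _; rewrite -size_poly_gt0 ltnW.
have : p ^+ n.+1 %| D g by apply: dvdp_trans gDg; rewrite gE dvdp_mulr.
rewrite gE dD.2 (derivation_exp dD) dvdp_addl; last exact: dvdp_mulr.
rewrite -[_ *+ n.+1]mulr_natl -polyC_natr mul_polyC.
rewrite -scalerAl dvdpZr; last by rewrite ((pcharf0P U).1 U0).
rewrite exprSr -mulrA dvdp_mul2l ?expf_neq0 //.
exact: irreducible_dvdM.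
Qed.

Lemma irreducible_quotient p : irreducible_poly p ->
  exists (L : fieldType) (q : {rmorphism {poly U} -> L}),
    (forall x, exists f, x = q f) /\ (forall f, q f = 0 <-> p %| f).
Proof.
move=> p_irr; have p0 : p != 0 by case: p_irr => p1 _; rewrite -size_poly_gt0 ltnW.
have lp0 : (lead_coef p)^-1 != 0 by rewrite invr_neq0 ?lead_coef_eq0.
(* The quotient field is formed with a monic irreducible polynomial, so [p] is normalized first. *)
pose p' := (lead_coef p)^-1 *: p.
have p'p : p' %= p by exact: eqp_scale.
have p'M : p' \is monic by rewrite monicE lead_coefZ mulVf ?lead_coef_eq0.
have p'I : monic_irreducible_poly p'.
  split=> //; case: p_irr => p1 p_irr; split; first by rewrite (eqp_size p'p).
  move=> h h1; rewrite (eqp_dvdr _ p'p) => /(p_irr h h1) /eqp_trans; apply.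
  by rewrite eqp_sym.
pose q : {poly U} -> {poly %/ p' with p'I} := in_qpoly p'.
have qB : zmod_morphism q by move=> x y; exact: (raddfB (in_qpoly p')).
have qM : monoid_morphism q.
  by split=> [|x y]; [exact: in_qpoly1 | exact: in_qpolyM].
pose q1 := GRing.isZmodMorphism.Build _ _ q qB.
pose q2 := GRing.isMonoidMorphism.Build _ _ q qM.
pose qh : {rmorphism {poly U} -> {poly %/ p' with p'I}} := HB.pack q q1 q2.
exists {poly %/ p' with p'I}, qh; split=> [x|f].
  by exists (@polyn U _ x); apply/val_inj/esym/in_qpoly_small/size_mk_monic.
rewrite -(eqp_dvdl _ p'p) /=; split=> [/(congr1 val) /= | p'f].
  rewrite (mk_monicE p'I) => qf0.
  by rewrite Pdiv.Idomain.dvdpE /Pdiv.Ring.rdvdp qf0.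
apply/val_inj => /=; rewrite (mk_monicE p'I).
by move: p'f; rewrite Pdiv.Idomain.dvdpE => /eqP.
Qed.

End IrreducibleFactors.

(** * Twisted derivations of polynomial rings *)

Section PolyDerivation.
Variables (A : comNzRingType) (d : A -> A).
Hypothesis dd : derivation d.
Implicit Types (f g T : {poly A}).

Lemma coef_map_derivation f n : (map_poly d f)`_n = d f`_n.
Proof. exact: coef_map_id0 (derivation0 dd). Qed.

Lemma map_poly_derivation : derivation (map_poly d).
Proof.
split=> f g; apply/polyP => n.
  by rewrite coefD !coef_map_derivation coefD dd.1.
rewrite coefD coef_map_derivation !coefM (big_morph d dd.1 (derivation0 dd)).
rewrite -big_split; apply: eq_bigr => i _.
by rewrite !coef_map_derivation dd.2.
Qed.

(* The derivation [X^e d] of [A[X]] that maps [X] to [T]. *)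
Definition twist (e : nat) T f : {poly A} := 'X^e * map_poly d f + T * f^`().

Lemma twist_derivation e T : derivation (twist e T).
Proof.
have dm := map_poly_derivation.
by split=> f g; rewrite /twist ?dm.1 ?dm.2 ?derivD ?derivM /=; ring.
Qed.

Lemma twistX e T : twist e T 'X = T.
Proof.
rewrite /twist derivX mulr1 -[RHS]add0r; congr (_ + _).
suff -> : map_poly d 'X = 0 by rewrite mulr0.
apply/polyP => n; rewrite coef_map_derivation coefX coef0.
by case: (n == 1%N); rewrite /= ?(derivation1 dd) ?(derivation0 dd).
Qed.

Lemma twistC e T a : twist e T a%:P = 'X^e * (d a)%:P.
Proof.
rewrite /twist derivC mulr0 addr0; congr (_ * _); apply/polyP => n.
rewrite coef_map_derivation !coefC.
by case: (n == 0%N); rewrite // (derivation0 dd).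
Qed.

End PolyDerivation.

Lemma map_twist (A B : comNzRingType) (phi : {rmorphism A -> B}) d d' e T f :
    derivation d -> derivation d' -> (forall x, phi (d x) = d' (phi x)) ->
  map_poly phi (twist d e T f) = twist d' e (map_poly phi T) (map_poly phi f).
Proof.
move=> dd dd' phid; rewrite /twist rmorphD !rmorphM /= map_polyXn deriv_map.
congr (_ * _ + _); apply/polyP => n.
by rewrite coef_map !(coef_map_derivation dd, coef_map_derivation dd') coef_map /= phid.
Qed.

(** Both sides are derivations in [f] along evaluation at [c], and they agree on constants and on
    ['X]. Consequently polynomials vanishing at [c] are mapped to polynomials vanishing at [c]. *)
Lemma horner_twist (A : comNzRingType) (d : A -> A) e T c f :
    derivation d -> c ^+ e * d c = T.[c] ->
  (twist d e T f).[c] = c ^+ e * d f.[c].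
Proof.
move=> dd cT; have dt := twist_derivation dd e T.
elim/poly_ind: f => [|f a IH].
  by rewrite (derivation0 dt) horner0 (derivation0 dd) mulr0.
rewrite dt.1 dt.2 twistX // twistC //.
move: (twist d e T f) IH => g IH; rewrite !hornerE IH dd.1 dd.2 -cT /=.
by ring.
Qed.

Lemma evd_of_dp m (K : dfieldType m) (I : choiceType) (A : comNzRingType)
    (h : {rmorphism K -> A}) d (a : I -> A) (f : diffpoly K I) :
  dpeval h d a (of_dp f) = evd (diffpoly K I) h d a f.
Proof. by rewrite -(evdE (diffpoly K I)) of_dpK. Qed.

(** * Solutions of the system at a root of an invariant polynomial *)

Section FlowPoint.
Variables (m : nat) (U : dfieldType m) (Q : 'I_m -> {poly U}) (p : {poly U}).
Let D i := twist (@der m U i) 0 (Q i).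
Hypothesis p_irr : irreducible_poly p.
Hypothesis pD : forall i, p %| D i p.
Hypothesis pC : forall i j, p %| D i (Q j) - D j (Q i).

Lemma twist_dvd i f : p %| f -> p %| D i f.
Proof.
move=> /dvdpP[h ->]; rewrite /D (twist_derivation (der_derivation U i) _ _).2.
by apply: dvdp_add; [exact: dvdp_mull (dvdpp p) | exact: dvdp_mull (pD i)].
Qed.

(** The commutator is a derivation that kills the constants, so it is controlled by its value at
    ['X], which is the integrability defect in [pC]. *)
Lemma twist_comm_dvd i j f : p %| D i (D j f) - D j (D i f).
Proof.
have dD k : derivation (D k) := twist_derivation (der_derivation U k) 0 (Q k).
pose E g := D i (D j g) - D j (D i g); rewrite -/(E f).
have dE : derivation E := commutator_derivation (dD i) (dD j).
have EC a : E a%:P = 0.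
  have DC k b : D k b%:P = (der k b)%:P.
    by rewrite /D (twistC (der_derivation U k)) expr0 mul1r.
  by rewrite /E !DC derC subrr.
have EX : p %| E 'X.
  by rewrite /E /D !(twistX (der_derivation U _)); exact: pC.
elim/poly_ind: f => [|f a IH]; first by rewrite (derivation0 dE) dvdp0.
rewrite dE.1 dE.2 EC addr0; apply: dvdp_add.
  exact: dvdp_mulr IH.
exact: dvdp_mull EX.
Qed.

(** The extension is [U[X]/p]: the derivations [D i] preserve the ideal of [p] and commute modulo
    it, so they descend, and the class of ['X] is the solution. *)
Lemma flow_extension : exists (L : dfieldType m) (e : {rmorphism U -> L}) (x : L),
  [/\ dmorphism e, forall i, der i x = (map_poly e (Q i)).[x]
    & (map_poly e p).[x] = 0].
Proof.
have dD k : derivation (D k) := twist_derivation (der_derivation U k) 0 (Q k).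
have [L [q [qS q0]]] := irreducible_quotient p_irr.
(* [s] chooses representatives; by [twist_dvd] the derivation induced on the quotient does not
   depend on the choice. *)
pose s x := sval (cid (qS x)).
have sK x : q (s x) = x by rewrite /s; case: cid.
pose dL i x := q (D i (s x)).
have dLE i f : dL i (q f) = q (D i f).
  apply/eqP; rewrite -subr_eq0 -rmorphB -(derivationN (dD i)) -(dD i).1.
  by apply/eqP/q0/twist_dvd/q0; rewrite rmorphB sK subrr.
have dLD i : {morph dL i : x y / x + y}.
  move=> x y; rewrite -(sK x) -(sK y) -rmorphD !dLE (dD i).1.
  exact: rmorphD.
have dLM i x y : dL i (x * y) = dL i x * y + x * dL i y.
  rewrite -(sK x) -(sK y) -rmorphM !dLE (dD i).2.
  by rewrite rmorphD !rmorphM.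
have dLC i j x : dL i (dL j x) = dL j (dL i x).
  rewrite -(sK x) !dLE; apply/eqP; rewrite -subr_eq0 -rmorphB.
  exact/eqP/q0/twist_comm_dvd.
pose e : {rmorphism U -> L} := q \o polyC.
have L0 : [pchar L] =i pred0 by move=> n; rewrite (fmorph_pchar e) dfield_char0.
pose L' := DField dLD dLM dLC L0.
have eE f : (map_poly e f).[q 'X] = q f.
  elim/poly_ind: f => [|f a IH]; first by rewrite rmorph0 horner0 rmorph0.
  rewrite rmorphD rmorphM /= map_polyX map_polyC !hornerE IH.
  by rewrite rmorphD rmorphM.
exists L', e, (q 'X); split=> [i c|i|].
- by rewrite /= dLE /D (twistC (der_derivation U i)) expr0 mul1r.
- by rewrite /= eE dLE /D (twistX (der_derivation U i)).
- by rewrite eE; exact/q0/dvdpp.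
Qed.

Lemma flow_point : DCF U ->
  exists2 c : U, (forall i, der i c = (Q i).[c]) & p.[c] = 0.
Proof.
move=> U_DCF; have [L [e [x [ed xQ xp]]]] := flow_extension.
pose G := diffpoly U 'I_1.
pose P (f : {poly U}) : G := (map_poly (cst G) f).[X G 0].
pose eqn i : G := ddp i (X G 0) - P (Q i).
pose s := [seq of_dp (eqn i) | i : 'I_m] ++ [:: of_dp (P p)].
have evP (M : dfieldType m) (h : {rmorphism U -> M}) y f :
    evd G h (@der m M) (fun=> y) (P f) = (map_poly h f).[y].
  rewrite /P -horner_map evd_X -map_poly_comp.
  congr (_.[_]); apply: eq_map_poly => c /=; exact: evd_cst.
have evE (M : dfieldType m) (h : {rmorphism U -> M}) y i : dmorphism h ->
    evd G h (@der m M) (fun=> y) (eqn i) = der i y - (map_poly h (Q i)).[y].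
  move=> hd; rewrite /eqn rmorphB evP evd_der ?evd_X //.
  - exact: der_derivation.
  - exact: derC.
(* Existential closedness is applied to the flow equations and [p = 0], with [1 <> 0] as the
   inequation. *)
have [|a [as0 _]] := U_DCF L e ed 1%N s (of_dp (1 : G)).
  exists (fun=> x); rewrite evd_of_dp rmorph1; split; last exact/eqP/oner_neq0.
  move=> f; rewrite mem_cat => /orP[/mapP[i _ ->]|]; last first.
    by rewrite inE => /eqP ->; rewrite evd_of_dp evP.
  by rewrite evd_of_dp evE // xQ subrr.
have aE : a = fun=> a 0 by apply: funext => i; rewrite ord1.
exists (a 0) => [i|].
  have /as0 : of_dp (eqn i) \in s.
    by rewrite mem_cat; apply/orP; left; apply/mapP; exists i; rewrite ?mem_enum.
  rewrite (evd_of_dp idfun) aE evE // => /eqP; rewrite subr_eq0 => /eqP ->.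
  by rewrite map_poly_id.
have /as0 : of_dp (P p) \in s by rewrite mem_cat mem_seq1 eqxx orbT.
by rewrite (evd_of_dp idfun) aE evP map_poly_id.
Qed.

End FlowPoint.

(** * Extension of specializations *)

Section ReversePoly.
Variable A : comNzRingType.
Implicit Type f : {poly A}.

(** The reciprocal polynomial [X^n f(1/X)], where [n] is the degree of [f] over [A]. This degree is
    kept even when a morphism kills the leading coefficient, so that reversal is compatible with
    every specialization. *)
Definition rev_poly f : {poly A} := \poly_(i < size f) f`_((size f).-1 - i).

Lemma size_rev_poly f : (size (rev_poly f) <= size f)%N.
Proof. exact: size_poly. Qed.

Lemma horner_rev_poly (B : comNzRingType) (phi : {rmorphism A -> B}) f (c z : B) :
  c * z = 1 ->
  (map_poly phi (rev_poly f)).[z] = z ^+ (size f).-1 * (map_poly phi f).[c].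
Proof.
move=> cz; have [->|f0] := eqVneq f 0.
  by rewrite /rev_poly size_poly0 poly_def big_ord0 !rmorph0 !horner0 mulr0.
pose n := (size f).-1; have sf : size f = n.+1 by rewrite prednK // size_poly_gt0.
rewrite (@horner_coef_wide _ n.+1); last first.
  by rewrite -sf; apply: leq_trans (size_poly _ _) (size_rev_poly f).
rewrite (@horner_coef_wide _ n.+1 (map_poly _ f)); last by rewrite -sf size_poly.
rewrite (reindex_inj rev_ord_inj) mulr_sumr; apply: eq_bigr => i _.
have le_in : (i <= n)%N by rewrite -ltnS.
rewrite /= subSS !coef_map coef_poly sf ltnS leq_subr /= subKn //.
have -> : z ^+ n = z ^+ (n - i) * z ^+ i by rewrite -exprD subnK.
transitivity (phi f`_i * z ^+ (n - i) * (c * z) ^+ i); first by rewrite cz expr1n mulr1.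
by rewrite exprMn; ring.
Qed.

End ReversePoly.

Lemma lead_cancel (U : fieldType) (p q : {poly U}) : q != 0 -> (size q <= size p)%N -> p != 0 ->
  (size (lead_coef q *: p - lead_coef p *: ('X^(size p - size q) * q))%R < size p)%N.
Proof.
move=> q0 le_qp p0.
have sq : (0 < size q)%N by rewrite size_poly_gt0.
have sp : size p = (size p).-1.+1 by rewrite prednK // size_poly_gt0.
rewrite [X in (_ < X)%N]sp ltnS; apply/leq_sizeP => n le_n.
rewrite coefB !coefZ coefXnM; case: ltnP => lt_n; first by move: sq sp; lia.
have [n_eq|n_neq] := eqVneq n (size p).-1.
  rewrite n_eq -lead_coefE; have -> : ((size p).-1 - (size p - size q))%N = (size q).-1.
    by move: sq sp le_qp; lia.
  by rewrite -lead_coefE mulrC subrr.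
have lt_pn : (size p <= n)%N by rewrite sp ltn_neqAle eq_sym n_neq.
have le_q : (size q <= n - (size p - size q))%N.
  by move: (size p) (size q) le_qp lt_pn => a b; lia.
by rewrite (nth_default _ lt_pn) (nth_default _ le_q) !mulr0 subr0.
Qed.

(** * Relations of a point and their specializations *)

Section Specialization.
Variables (m : nat) (F U : dfieldType m) (iota : {rmorphism F -> U}).
Variables (A : comNzRingType) (dA : 'I_m -> A -> A) (hA : {rmorphism F -> A}).
Variables (alpha beta : {rmorphism A -> U}).
Hypothesis U_DCF : DCF U.
Hypothesis dA_derivation : forall i, derivation (dA i).
Hypothesis alpha_der : forall i x, alpha (dA i x) = der i (alpha x).
Hypothesis beta_der : forall i x, beta (dA i x) = der i (beta x).
Hypothesis alpha_hA : forall x, alpha (hA x) = iota x.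
Hypothesis beta_hA : forall x, beta (hA x) = iota x.
Hypothesis specialize : forall x, alpha x = 0 -> beta x = 0.
Implicit Types (f g e s : {poly A}) (c z : U).

(** The ideal of relations of [c] over [A]: the kernel of evaluation at [c] through [alpha]. *)
Definition ann c f := (map_poly alpha f).[c] = 0.

Lemma ann_comb c f g s t : ann c f -> ann c g -> ann c (s * f - t * g).
Proof.
by rewrite /ann => f0 g0; rewrite rmorphB !rmorphM hornerD hornerN !hornerM f0 g0 !mulr0 subr0.
Qed.

Lemma annM c f s : ann c f -> ann c (s * f).
Proof. by rewrite /ann => f0; rewrite rmorphM hornerM f0 mulr0. Qed.

Lemma ann_rev c z f : c * z = 1 -> ann c f -> ann z (rev_poly f).
Proof. by move=> cz; rewrite /ann (horner_rev_poly _ _ cz) => ->; rewrite mulr0. Qed.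

Lemma ann_twist c f n T i : c ^+ n * der i c = (map_poly alpha T).[c] ->
  ann c f -> ann c (twist (dA i) n T f).
Proof.
move=> cT f0; rewrite /ann (map_twist _ _ _ (dA_derivation i) (der_derivation U i)) //.
by rewrite (horner_twist _ (der_derivation U i) cT) f0 (derivation0 (der_derivation U i)) mulr0.
Qed.

(** Division by a non-zero image of minimal degree. Each step is carried out on the relations over
    [A] themselves, so that what remains is again the image of a relation. *)
Lemma ann_generator c : (forall f, ann c f -> map_poly beta f = 0) \/
  exists2 f, ann c f & map_poly beta f != 0 /\
    forall g, ann c g -> map_poly beta f %| map_poly beta g.
Proof.
pose P n := `[< exists2 f, ann c f & map_poly beta f != 0 /\ size (map_poly beta f) = n >].
have [exP|nP] := EM (exists n, P n); last first.
  left=> f f0; apply/eqP; apply: contrapT => /negP bf0; apply: nP.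
  by exists (size (map_poly beta f)); apply/asboolP; exists f.
right; case: (ex_minnP exP) => n /asboolP[f f0 [bf0 sf]] min_n.
exists f => //; split=> // g; have [k] := ubnP (size (map_poly beta g)).
elim: k g => // k IH g ltk g0.
have [->|bg0] := eqVneq (map_poly beta g) 0; first by rewrite dvdp0.
have le_fg : (size (map_poly beta f) <= size (map_poly beta g))%N.
  by rewrite sf; apply: min_n; apply/asboolP; exists g.
pose l := (size (map_poly beta g) - size (map_poly beta f))%N.
(* [u] and [v] lift the leading coefficients of the images; [f] and [g] may have higher terms that
   [beta] kills. *)
pose u := f`_(size (map_poly beta f)).-1.
pose v := g`_(size (map_poly beta g)).-1.
have /IH : ann c (u%:P * g - (v%:P * 'X^l) * f) by exact: ann_comb.
have -> : map_poly beta (u%:P * g - (v%:P * 'X^l) * f) =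
    lead_coef (map_poly beta f) *: map_poly beta g
    - lead_coef (map_poly beta g) *: ('X^l * map_poly beta f).
  rewrite rmorphB !rmorphM /= !map_polyC map_polyXn -!mul_polyC mulrA.
  by rewrite !lead_coefE !coef_map.
move=> H; have := H (leq_trans (lead_cancel bf0 le_fg bg0) ltk).
rewrite dvdp_subl ?dvdpZr ?dvdp_mull ?lead_coef_eq0 //.
Qed.

(* [c] and [1/c] cannot both specialize to infinity, as in the extension theorem
   for places: the longer relation is shortened with the reversed shorter one. *)
Lemma chevalley n : forall c z f e (u v : U), c * z = 1 ->
    (size f + size e < n)%N -> ann c f -> ann z e ->
    map_poly beta f = u%:P -> map_poly beta e = v%:P -> u != 0 -> v != 0 -> False.
Proof.
elim: n => // n IH.
have bcoef g (w : U) i : map_poly beta g = w%:P -> beta g`_i = if i == 0%N then w else 0.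
  by move=> gw; rewrite -coef_map gw coefC.
have wlog_le c z f e (u v : U) : (size f <= size e)%N -> c * z = 1 ->
    (size f + size e < n.+1)%N -> ann c f -> ann z e ->
    map_poly beta f = u%:P -> map_poly beta e = v%:P -> u != 0 -> v != 0 -> False.
  move=> le_fe cz lt_n f0 e0 fu ev u0 v0.
  (* A constant relation is zero under [alpha], hence under [beta], against [u != 0]. *)
  have [lt1|le1] := ltnP 1 (size f); last first.
    move: f0; rewrite /ann (size1_polyC le1) map_polyC hornerC => /specialize.
    by rewrite (bcoef _ _ _ fu) => /eqP; rewrite (negPf u0).
  pose l := (size e).-1; pose k := (size f).-1.
  have l0 : (0 < l)%N by rewrite /l; move: lt1 le_fe; lia.
  (* The top coefficient of [rev_poly f] is [f]_0[, so the terms of degree]l[cancel. The subtracted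
     term specializes to zero because]beta[kills]e[_l] for [l > 0], which leaves the constant
     [u * v]. *)
  pose e' := f`_0 *: e - (e`_l *: 'X^(l - k)) * rev_poly f.
  have e'0 : ann z e'.
    by rewrite /e' -mul_polyC; apply: ann_comb => //; exact: ann_rev f0.
  have e'E : map_poly beta e' = (u * v)%:P.
    rewrite rmorphB !rmorphM /= -!mul_polyC !rmorphM /= !map_polyC /=.
    rewrite (bcoef _ _ _ fu) (bcoef _ _ _ ev) (gtn_eqF l0) ev eqxx polyC0.
    by rewrite !mul0r subr0 -polyCM.
  have lt_e' : (size e' <= l)%N.
    have sf : size f = k.+1 by rewrite prednK // ltnW.
    have se : size e = l.+1 by rewrite prednK // (leq_trans _ le_fe) // ltnW.
    have le_kl : (k <= l)%N by rewrite -ltnS -sf -se.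
    apply/leq_sizeP => i le_i; rewrite coefB coefZ -scalerAl coefZ coefXnM.
    rewrite coef_poly sf ltnNge (leq_trans (leq_subr _ _) le_i) /=.
    have [<-|i_neq] := eqVneq l i; first by rewrite subKn // ltnSn subnn mulrC subrr.
    have lt_li : (l < i)%N by rewrite ltn_neqAle i_neq.
    rewrite [e`_i]nth_default ?se // mulr0 sub0r.
    by rewrite ifF ?mulr0 ?oppr0 //; apply/negbTE; rewrite -leqNgt; lia.
  apply: (IH c z f e' u (u * v)) => //; last by rewrite mulf_neq0.
  by move: lt_e' lt_n l0; rewrite /l; lia.
move=> c z f e u v cz lt_n f0 e0 fu ev u0 v0.
have [le_fe|/ltnW le_ef] := leqP (size f) (size e); first exact: (wlog_le c z f e u v).
by apply: (wlog_le z c e f v u) => //; rewrite 1?mulrC 1?addnC.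
Qed.

(** Here [r] bounds the multiplicity with which [z] specializes to [0]; for [r = 0] a relation of
    [z] becomes a non-zero constant, so [z] has no finite specialization. *)
Definition infinitesimal z r :=
  exists2 e, ann z e & exists2 u : U, u != 0 & map_poly beta e = u *: 'X^r.

(** Only the constant coefficient of [f] survives under [beta], and reversal moves it to the top. *)
Lemma infinitesimal_rev c z f (u : U) : c * z = 1 -> ann c f ->
  map_poly beta f = u%:P -> u != 0 -> infinitesimal z (size f).-1.
Proof.
move=> cz f0 fu u0; exists (rev_poly f); first exact: ann_rev f0.
exists u => //; apply/polyP => i; rewrite coef_map coef_poly coefZ coefXn.
have bcoef j : beta f`_j = if j == 0%N then u else 0 by rewrite -coef_map fu coefC.
have sf : (0 < size f)%N.
  rewrite size_poly_gt0; apply: contraNneq u0 => f00; move: fu.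
  by rewrite f00 rmorph0 => /esym/eqP; rewrite polyC_eq0.
case: ltnP => le_i; last first.
  by rewrite /= rmorph0 gtn_eqF ?mulr0 // prednK.
rewrite /= bcoef; have -> : (i == (size f).-1) = ((size f).-1 - i == 0)%N.
  by rewrite subn_eq0 eqn_leq -ltnS prednK // le_i.
by case: eqP => _; rewrite ?mulr1 ?mulr0.
Qed.

Lemma infinitesimal_pred z r g s (w : U) : infinitesimal z r.+1 -> ann z g ->
  w != 0 -> map_poly beta g = 'X^r * (w%:P + 'X * map_poly beta s) ->
  infinitesimal z r.
Proof.
move=> [e e0 [u u0 eE]] g0 w0 gE; exists ((e`_r.+1)%:P * g - s * e).
  exact: ann_comb.
have be : beta e`_r.+1 = u by rewrite -coef_map eE coefZ coefXn eqxx mulr1.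
exists (u * w); first by rewrite mulf_neq0.
rewrite rmorphB !rmorphM /= map_polyC /= be gE eE -!mul_polyC polyCM exprS.
by ring.
Qed.

(** The derivation sending ['X] to [T] maps [u X^(r+1)] to [(r+1) u X^r T] plus a multiple of
    [X^(r+1)]. As the constant term of [T] survives and the characteristic is zero,
    [infinitesimal_pred] applies; writing [T] as [T' X + t] isolates that term. *)
Lemma infinitesimal_twist z r n T i : infinitesimal z r.+1 ->
  z ^+ n * der i z = (map_poly alpha T).[z] -> beta T`_0 != 0 ->
  infinitesimal z r.
Proof.
move=> zr zT T0; case: (zr) => e e0 [u u0 eE].
have be : beta e`_r.+1 = u by rewrite -coef_map eE coefZ coefXn eqxx mulr1.
elim/poly_ind: T zT T0 => [|T t _]; first by move=> _; rewrite coef0 rmorph0 eqxx.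
rewrite coefD coefMX coefC add0r /= => zT t0.
apply: (infinitesimal_pred (g := twist (dA i) n (T * 'X + t%:P) e)
  (s := e`_r.+1 *+ r.+1 *: T + dA i e`_r.+1 *: 'X^n)
  (w := u * beta t *+ r.+1) zr) => //.
- exact: ann_twist.
- rewrite -mulr_natr mulf_neq0 ?mulf_neq0 //.
  by rewrite ((pcharf0P U).1 (@dfield_char0 _ U)).
rewrite (map_twist _ _ _ (dA_derivation i) (der_derivation U i)) // eE.
rewrite /twist derivZ derivXn /=.
have -> : map_poly (der i) (u *: 'X^(r.+1)) = der i u *: 'X^(r.+1).
  apply/polyP => j; rewrite (coef_map_derivation (der_derivation U i)) !coefZ coefXn.
  by case: (j == _); rewrite ?mulr1 ?mulr0 ?(derivation0 (der_derivation U i)).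
rewrite !rmorphD !rmorphM /= -!mul_polyC !rmorphM /= !map_polyC /= map_polyX map_polyXn.
rewrite beta_der (rmorphMn beta) be !polyCMn polyCM exprS.
by ring.
Qed.

Variable P : 'I_m -> {poly F}.
Let flow c := forall i, der i c = (map_poly iota (P i)).[c].

Lemma map_alpha_hA (f : {poly F}) : map_poly alpha (map_poly hA f) = map_poly iota f.
Proof. by rewrite -map_poly_comp; apply: eq_map_poly => x; exact: alpha_hA. Qed.

Lemma map_beta_hA (f : {poly F}) : map_poly beta (map_poly hA f) = map_poly iota f.
Proof. by rewrite -map_poly_comp; apply: eq_map_poly => x; exact: beta_hA. Qed.

Lemma flow_finite c : flow c ->
  (exists2 c', flow c' & forall f, ann c f -> (map_poly beta f).[c'] = 0) \/
  (exists2 f, ann c f & exists2 u : U, u != 0 & map_poly beta f = u%:P).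
Proof.
move=> cP; pose D i := twist (dA i) 0 (map_poly hA (P i)).
have annD i f : ann c f -> ann c (D i f).
  by apply: ann_twist; rewrite map_alpha_hA expr0 mul1r.
have bD i f : map_poly beta (D i f) =
    twist (@der m U i) 0 (map_poly iota (P i)) (map_poly beta f).
  by rewrite (map_twist _ _ _ (dA_derivation i) (der_derivation U i)) // map_beta_hA.
have [all0|[f f0 [bf0 fdvd]]] := ann_generator c.
  by left; exists c => // f /all0 ->; rewrite horner0.
have [le1|lt1] := leqP (size (map_poly beta f)) 1.
  right; exists f => //; exists (map_poly beta f)`_0; last exact: size1_polyC.
  by apply: contraNneq bf0 => b0; rewrite (size1_polyC le1) b0.
have [p p_irr pf] := irreducible_factor lt1; left.
have [|||c' c'P pc'] := @flow_point m U (fun i => map_poly iota (P i)) p p_irr.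
- move=> i.
  apply: (irreducible_dvd_derivation (@dfield_char0 _ U)
    (twist_derivation (der_derivation U i) 0 _) p_irr bf0 pf).
  by rewrite -bD; exact/fdvd/annD.
(* The integrability defect is the image of a relation of [c], because the derivations of [U]
   commute on [c]; hence the generator divides it. *)
- move=> i j; apply: dvdp_trans pf _.
  have bE k l : twist (@der m U k) 0 (map_poly iota (P k)) (map_poly iota (P l))
      = map_poly beta (D k (map_poly hA (P l))) by rewrite bD map_beta_hA.
  rewrite !bE -rmorphB; apply: fdvd.
  have hE k l : (map_poly alpha (D k (map_poly hA (P l)))).[c] = der k (der l c).
    rewrite (map_twist _ _ _ (dA_derivation k) (der_derivation U k)) //.
    rewrite !map_alpha_hA (horner_twist _ (der_derivation U k)).
      by rewrite expr0 mul1r -cP.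
    by rewrite expr0 mul1r cP.
  by rewrite /ann rmorphB hornerD hornerN !hE derC subrr.
- exact: U_DCF.
exists c' => // g /fdvd; move/(dvdp_trans pf)/dvdpP => [h ->].
by rewrite hornerM pc' mulr0.
Qed.

Lemma flow_infinite c f (u : U) : flow c -> ann c f -> u != 0 ->
  map_poly beta f = u%:P ->
  [/\ c != 0, forall i, (size (P i) <= 2)%N
    & forall g, ann c^-1 g -> (map_poly beta g).[0] = 0].
Proof.
move=> cP f0 u0 fu.
have bf : beta f`_0 = u by rewrite -coef_map fu coefC.
have c0 : c != 0.
  apply: contraNneq u0 => c0; move: f0; rewrite /ann c0 horner_coef0 coef_map.
  by move/specialize; rewrite bf => ->.
have cz : c * c^-1 = 1 by rewrite divff.
have := infinitesimal_rev cz f0 fu u0; move: (_.-1) => r zr.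
(* Descending to exponent [0] yields a relation of [c^-1] with non-zero constant image, while [f] is
   such a relation of [c]; [chevalley] excludes this. *)
have absurd (Q : Prop) : (forall k, infinitesimal c^-1 k.+1 -> infinitesimal c^-1 k) -> Q.
  move=> step; case: notF; apply/negP => _.
  have : infinitesimal c^-1 0 by elim: r zr => // r IH /step.
  move=> [e e0 [v v0]]; rewrite expr0 -[v *: 1]/(v%:A) alg_polyC => ev.
  exact: (chevalley cz (leqnn _) f0 e0 fu ev u0 v0).
split=> // [i|g].
  rewrite leqNgt; apply/negP => lt_P; apply: absurd => k zk.
  (* With [z = 1/c] and [d] the degree of [P i], one has [z^(d-2) * der i z = - z^d P_i(1/z)]. This
     is the negated reciprocal polynomial at [z], whose constant term is minus the leading
     coefficient of [P i]. *)
  pose T := - map_poly hA (rev_poly (P i)).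
  apply: (infinitesimal_twist (n := (size (P i)).-1.-2) (T := T) (i := i) zk).
    rewrite /T rmorphN /= hornerN map_alpha_hA (horner_rev_poly _ _ cz) -cP.
    rewrite (der_inv _ c0) mulrN mulrA -exprD; congr (- (_ ^+ _ * _)).
    by case: (size (P i)) lt_P => [|[|[|n]]] //= _; rewrite addn2.
  have P0 : P i != 0 by rewrite -size_poly_gt0 (leq_trans _ lt_P).
  rewrite /T coefN rmorphN oppr_eq0 coef_map beta_hA fmorph_eq0 coef_poly.
  by rewrite size_poly_gt0 P0 subn0 -lead_coefE lead_coef_eq0.
elim/poly_ind: g => [|g b _] g0; first by rewrite rmorph0 horner0.
apply/eqP; apply: contrapT => /negP.
rewrite horner_coef0 coef_map coefD coefMX coefC add0r /= => b0.
apply: absurd => k zk.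
(* A relation whose image has non-zero constant term lowers the exponent after multiplication by
   ['X^k]. *)
apply: (infinitesimal_pred (g := 'X^k * (g * 'X + b%:P)) (s := g) zk _ b0).
  exact: annM.
rewrite !rmorphM rmorphD rmorphM /= map_polyXn map_polyX map_polyC /=.
by ring.
Qed.

End Specialization.

(** * Closures, saturation and completeness *)

Local Open Scope classical_set_scope.

Section Geometry.
Variables (m : nat) (F U : dfieldType m) (iota : {rmorphism F -> U}).
Hypothesis iota_der : dmorphism iota.

Definition evU (I : choiceType) (x : I -> U) : {rmorphism diffpoly F I -> U} :=
  evd (diffpoly F I) iota (@der m U) x.

Lemma evU_der (I : choiceType) (x : I -> U) i f :
  evU x (ddp i f) = der i (evU x f).
Proof. by apply: evd_der; [exact: der_derivation | exact: derC | exact: iota_der]. Qed.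

Lemma dzeroE (I : choiceType) (x : I -> U) (f : dpoly F I) :
  dzero iota f x <-> evU x (dp_of (diffpoly F I) f) = 0.
Proof. by rewrite /dzero /evU evdE. Qed.

Lemma dzero_of_dp (I : choiceType) (x : I -> U) (f : diffpoly F I) :
  dzero iota (of_dp f) x <-> evU x f = 0.
Proof. by rewrite dzeroE of_dpK. Qed.

Lemma homogenization (I : choiceType) (j : I) (f : diffpoly F I) :
  exists d g, homogeneous predT d g /\ forall x : I -> U, x j != 0 ->
    evU x g = x j ^+ d * evU (fun i => x i / x j) f.
Proof.
have [d [g [gd gE]]] := homogenize j iota_der f; exists d, g; split=> // x xj.
rewrite /evU -(gE _ (divff xj)) -(homogeneous_ev iota_der gd).
by apply: eq_evd => i /=; rewrite mulrC divfK.
Qed.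

Lemma dclosureE n (X : set (hvec U n)) x : dclosure iota X x <->
  forall f d, homogeneous predT d f ->
    (forall y, X y -> evU (hcoord y) f = 0) -> evU (hcoord x) f = 0.
Proof.
split=> [Xx f d fd fX|Xx C [S [Sd ->]] XS f Sf].
  have /Xx H : dclosed iota [set x | dzero iota (of_dp f) (hcoord x)].
    exists [set of_dp f]; split=> [_ ->|]; first by exists d; apply/dhomogE; rewrite of_dpK.
    by apply/seteqP; split=> y /=; [move=> yf _ -> | exact].
  by apply/dzero_of_dp; apply: H => y /fX /dzero_of_dp.
have [d /dhomogE fd] := Sd f Sf.
by apply/dzeroE; apply: Xx fd _ => y /XS /(_ f Sf) /dzeroE.
Qed.

Lemma dclosure_closed n (X : set (hvec U n)) : dclosed iota (dclosure iota X).
Proof.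
exists [set f | (exists d, dhomog predT d f) /\
  forall y, X y -> dzero iota f (hcoord y)]; split=> [f []//|].
apply/seteqP; split=> x /= => [Xx f [[d /dhomogE fd] fX]|H].
  by apply/dzeroE; apply: ((dclosureE X x).1 Xx) fd _ => y /fX /dzeroE.
apply/dclosureE => f d fd fX; apply/dzero_of_dp; apply: H; split.
  by exists d; apply/dhomogE; rewrite of_dpK.
by move=> y /fX /dzero_of_dp.
Qed.

Lemma hvec_of n (x : 'I_n.+1 -> U) : (exists i, x i != 0) ->
  exists p : hvec U n, hcoord p = x.
Proof.
move=> [i xi]; have x0 : \row_i x i != 0.
  by apply: contraNneq xi => /rowP/(_ i); rewrite !mxE => ->.
by exists (exist (fun x : 'rV[U]_n.+1 => x != 0) _ x0); apply: funext => j; rewrite /hcoord /= mxE.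
Qed.

Lemma hcoord_neq0 n (p : hvec U n) : exists i, hcoord p i != 0.
Proof. by case: p => x x0; have /rV0Pn[i xi] := x0; exists i. Qed.

Lemma dterm_of (I : choiceType) n (r : I -> 'I_n) (f : diffpoly F I) :
  exists t : dterm m {x : U | range iota x} n,
    forall a, Defs.tval sval a t = evU (fun i => a (r i)) f.
Proof.
move: f; apply: dp_ind => [c|i|f g [t tE] [u uE]|f g [t tE] [u uE]|i f [t tE]].
- have ic : range iota (iota c) by exists c.
  by exists (TPar m n (exist _ (iota c) ic)) => a; rewrite /= /evU evd_cst.
- by exists (TVar m _ (r i)) => a; rewrite /= /evU evd_X.
- by exists (TAdd t u) => a; rewrite /= tE uE rmorphD.
- by exists (TMul t u) => a; rewrite /= tE uE rmorphM.
- by exists (TDer i t) => a; rewrite /= tE evU_der.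
Qed.

Lemma zero_formula (I : choiceType) n (r : I -> 'I_n) (f : diffpoly F I) :
  exists phi : dformula m {x : U | range iota x} n,
    forall a, fholds sval phi a <-> evU (fun i => a (r i)) f = 0.
Proof.
have [t tE] := dterm_of r f; exists (FEq t (TZero _ _ _)) => a /=.
by rewrite tE.
Qed.

(* The closure under finite products of the inequations [g <> 0] makes the type
   finitely satisfiable. *)
Lemma generic_point (U_sat : saturated_over F U) (I : choiceType) n
    (r : I -> 'I_n) (b : I -> U) (base : ('I_n -> U) -> Prop) :
    (forall a, (forall phi : dformula m {x : U | range iota x} n,
       (forall a', base a' -> fholds sval phi a') -> fholds sval phi a) -> base a) ->
    (forall g, evU b g != 0 -> exists2 a, base a & evU (fun i => a (r i)) g != 0) ->
  exists2 a, base a & forall g, evU b g != 0 -> evU (fun i => a (r i)) g != 0.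
Proof.
move=> base_def sat.
pose Sigma : set (dformula m {x : U | range iota x} n) :=
  [set phi | (forall a, base a -> fholds sval phi a) \/
     exists2 g, evU b g != 0 &
       forall a, evU (fun i => a (r i)) g != 0 -> fholds sval phi a].
(* All parameters lie in the image of [F], within the bound of the saturation hypothesis. *)
have card_iota : (range iota #<= [set: F])%card by exact: card_image_le.
have [Sigma0 sub fin|a aS] := U_sat _ card_iota n Sigma.
  have /(@finite_seqP {classic _})[s Es] := fin.
  suff [g gb gs] : exists2 g, evU b g != 0 & forall a, base a ->
      evU (fun i => a (r i)) g != 0 -> forall phi, phi \in s -> fholds sval phi a.
    have [a ba ga] := sat g gb; exists a => phi.
    by rewrite Es => /= phis; exact: gs ba ga _ phis.
  have {sub Es} : forall phi, phi \in s -> Sigma phi.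
    by move=> phi phis; apply: sub; rewrite Es.
  elim: s => [_|phi s IH sS]; first by exists 1 => //; rewrite rmorph1 oner_neq0.
  have [|g gb gs] := IH; first by move=> psi ps; apply: sS; rewrite inE ps orbT.
  have [phib|[h hb hphi]] := sS phi (mem_head _ _).
    exists g => // a ba ga psi; rewrite inE => /orP[/eqP ->|]; first exact: phib.
    exact: gs.
  exists (h * g); first by rewrite rmorphM mulf_neq0.
  move=> a ba; rewrite rmorphM mulf_eq0 negb_or => /andP[ha ga] psi.
  by rewrite inE => /orP[/eqP ->|]; [exact: hphi | exact: gs].
exists a; first by apply: base_def => phi phib; apply: aS; left.
move=> g gb; have [phi phiE] := zero_formula r g.
have /aS : Sigma (FNot phi) by right; exists g => // a' /eqP ga' /phiE.
by move=> H; apply/eqP => /phiE.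
Qed.

(** Since [c] solves the system, the derivative of a polynomial expression in [c] is again one,
    given by [twist]. The same [g] serves all [alpha] and [c], so the values before and after
    specialization can be compared. *)
Lemma poly_reduction (A : comNzRingType) (dA : 'I_m -> A -> A)
    (hA : {rmorphism F -> A}) (I : choiceType) (Q : 'I_m -> {poly A})
    (q : I -> {poly A}) (f : diffpoly F I) :
    (forall i, derivation (dA i)) ->
  exists g : {poly A}, forall (alpha : {rmorphism A -> U}) (c : U),
    (forall i x, alpha (dA i x) = der i (alpha x)) ->
    (forall x, alpha (hA x) = iota x) ->
    (forall i, der i c = (map_poly alpha (Q i)).[c]) ->
  evU (fun i => (map_poly alpha (q i)).[c]) f = (map_poly alpha g).[c].
Proof.
move=> dd; move: f.
apply: dp_ind => [c|i|f g [s sE] [t tE]|f g [s sE] [t tE]|i f [s sE]].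
- exists (hA c)%:P => alpha x _ ah _.
  by rewrite /evU evd_cst map_polyC hornerC /= ah.
- by exists (q i) => alpha x _ _ _; rewrite /evU evd_X.
- by exists (s + t) => alpha x ad ah xQ; rewrite !rmorphD hornerD /= sE // tE.
- by exists (s * t) => alpha x ad ah xQ; rewrite !rmorphM hornerM /= sE // tE.
- exists (twist (dA i) 0 (Q i) s) => alpha x ad ah xQ.
  rewrite evU_der sE // (map_twist _ _ _ (dd i) (der_derivation U i)) //.
  by rewrite (horner_twist _ (der_derivation U i)) expr0 mul1r.
Qed.

End Geometry.

(** * Specializing the point of the closure *)

Section Completeness.
Variables (m : nat) (F U : dfieldType m) (iota : {rmorphism F -> U}).
Hypothesis iota_der : dmorphism iota.
Hypothesis U_DCF : DCF U.
Variable P : 'I_m -> {poly F}.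

Let flow (c : U) := forall i, der i c = (map_poly iota (P i)).[c].

Definition vec2 (x0 x1 : U) (i : 'I_2) := if i == 0 then x0 else x1.

Lemma vec2E (x : 'I_2 -> U) i : x i = vec2 (x 0) (x 1) i.
Proof.
rewrite /vec2; case: eqVneq => [-> //|i0]; congr x; apply: val_inj.
by case: i i0 => -[|[|]].
Qed.

Definition join k (x : 'I_2 -> U) (y : 'I_k.+1 -> U) (i : 'I_2 + 'I_k.+1) :=
  match i with inl j => x j | inr j => y j end.

Definition left_index k (i : 'I_2 + 'I_k.+1) := if i is inl _ then true else false.
Definition right_index k (i : 'I_2 + 'I_k.+1) := if i is inr _ then true else false.

Lemma evU_scale (I : choiceType) (B : pred I) d f (t : U) (x y : I -> U) :
    homogeneous B d f -> (forall i, y i = if B i then t * x i else x i) ->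
  evU iota x f = 0 -> evU iota y f = 0.
Proof.
move=> fd yE fx; rewrite /evU (eq_evd _ _ _ yE) (homogeneous_ev iota_der fd).
by rewrite [X in _ * X]fx mulr0.
Qed.

Definition in_closure (x : 'I_2 -> U) := forall f d, homogeneous predT d f ->
  (forall p, poly_flow iota P p -> evU iota (hcoord p) f = 0) -> evU iota x f = 0.

(** The homogenized flow equations vanish on the flow, hence at [x], and they can be dehomogenized
    where [x 1] is non-zero. *)
Lemma in_closure_flow x : in_closure x -> x 1 != 0 -> flow (x 0 / x 1).
Proof.
move=> xV x1 i; pose G := diffpoly F 'I_2.
pose f : G := ddp i (X G 0) - (map_poly (cst G) (P i)).[X G 0].
have fE y : evU iota y f = der i (y 0) - (map_poly iota (P i)).[y 0].
  rewrite rmorphB (evU_der iota_der) -horner_map -map_poly_comp /evU !evd_X.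
  by congr (_ - _.[_]); apply: eq_map_poly => c /=; exact: evd_cst.
have [d [g [gd gE]]] := homogenization iota_der (1 : 'I_2) f.
have /eqP : evU iota x g = 0.
  apply: xV gd _ => p [p1 pP]; rewrite gE // fE.
  by rewrite [X in _ * X](pP i) mulr0.
by rewrite gE // fE mulf_eq0 expf_eq0 (negPf x1) andbF subr_eq0 => /eqP.
Qed.

Lemma flow_in_closure c : flow c -> in_closure (vec2 c 1).
Proof.
move=> cP f d _ fP; have [|p pE] := @hvec_of m U 1 (vec2 c 1).
  by exists 1; rewrite /vec2 /= oner_neq0.
rewrite -pE; apply: fP; rewrite /poly_flow /= pE /vec2 /= oner_neq0 divr1.
by split=> // i; rewrite cP subrr.
Qed.

Section SpecialPoint.
Variables (k : nat) (y b : 'I_k.+1 -> U).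
Hypothesis spec : forall g : diffpoly F 'I_k.+1, evU iota b g != 0 -> evU iota y g != 0.
Let A := diffpoly F 'I_k.+1.
Let alpha := evU iota y.
Let beta := evU iota b.

Let dA : forall i, derivation (@ddp _ _ _ A i) := @ddp_derivation _ _ _ A.
Let alpha_der : forall i x, alpha (ddp i x) = der i (alpha x) := evU_der iota_der y.
Let beta_der : forall i x, beta (ddp i x) = der i (beta x) := evU_der iota_der b.
Let alpha_cst x : alpha (cst A x) = iota x. Proof. exact: evd_cst. Qed.
Let beta_cst x : beta (cst A x) = iota x. Proof. exact: evd_cst. Qed.
Let alpha_beta x : alpha x = 0 -> beta x = 0.
Proof. by move=> ax; apply/eqP; apply: contraTT isT => /spec/eqP. Qed.

(** [poly_reduction] turns the differential relation into a polynomial relation of [c] over [A],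
    which then specializes by hypothesis. *)
Lemma transfer (I : choiceType) (Q : 'I_m -> {poly F}) (q : I -> {poly A}) (c c' : U) f :
    (forall i, der i c = (map_poly iota (Q i)).[c]) ->
    (forall i, der i c' = (map_poly iota (Q i)).[c']) ->
    (forall g, ann alpha c g -> (map_poly beta g).[c'] = 0) ->
  evU iota (fun i => (map_poly alpha (q i)).[c]) f = 0 ->
  evU iota (fun i => (map_poly beta (q i)).[c']) f = 0.
Proof.
move=> cQ c'Q ann0.
have [g gE] := poly_reduction iota_der (cst A) (fun i => map_poly (cst A) (Q i)) q f dA.
rewrite (gE alpha) // => [/ann0 g0|i]; last by rewrite (map_alpha_hA alpha_cst).
by rewrite (gE beta) // => i; rewrite (map_alpha_hA beta_cst).
Qed.

Definition join_poly (q : 'I_2 -> {poly F}) (i : 'I_2 + 'I_k.+1) : {poly A} :=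
  match i with inl j => map_poly (cst A) (q j) | inr j => (X A j)%:P end.

Lemma transfer_join (Q : 'I_m -> {poly F}) (q : 'I_2 -> {poly F}) (c c' : U) f x x' :
    (forall i, der i c = (map_poly iota (Q i)).[c]) ->
    (forall i, der i c' = (map_poly iota (Q i)).[c']) ->
    (forall g, ann alpha c g -> (map_poly beta g).[c'] = 0) ->
    (forall i, x i = (map_poly iota (q i)).[c]) ->
    (forall i, x' i = (map_poly iota (q i)).[c']) ->
  evU iota (join x y) f = 0 -> evU iota (join x' b) f = 0.
Proof.
move=> cQ c'Q ann0 xE x'E.
have E1 : evU iota (join x y) f =
    evU iota (fun i => (map_poly alpha (join_poly q i)).[c]) f.
  apply: eq_evd => -[j|j] /=; first by rewrite (map_alpha_hA alpha_cst) xE.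
  by rewrite map_polyC hornerC; exact/esym/evd_X.
have E2 : evU iota (join x' b) f =
    evU iota (fun i => (map_poly beta (join_poly q i)).[c']) f.
  apply: eq_evd => -[j|j] /=; first by rewrite (map_alpha_hA beta_cst) x'E.
  by rewrite map_polyC hornerC; exact/esym/evd_X.
by rewrite E1 E2; exact: transfer cQ c'Q ann0.
Qed.

(** For [P_i = p_0 + p_1 X] the reciprocal [z = 1/c] satisfies [der i z = - z^2 P_i(1/z) = - (p_1 z
    + p_0 z^2)], the system in the chart at infinity. *)
Lemma infinite_flow c : c != 0 -> flow c -> (forall i, (size (P i) <= 2)%N) ->
  forall i, der i c^-1 =
    (map_poly iota (- ((P i)`_1 *: 'X + (P i)`_0 *: 'X^2))).[c^-1].
Proof.
move=> c0 cP P2 i.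
rewrite (der_inv _ c0) cP rmorphN rmorphD /= !map_polyZ map_polyX map_polyXn !hornerE.
rewrite (@horner_coef_wide _ 2); last by rewrite (leq_trans (size_poly _ _)) ?P2.
rewrite !big_ord_recl big_ord0 /= !coef_map /bump /= expr0 expr1.
by field.
Qed.

Lemma special_point (S : set (diffpoly F ('I_2 + 'I_k.+1)%type)) (x : 'I_2 -> U) :
    (forall f, S f -> exists d, homogeneous (@left_index k) d f) ->
    (exists i, x i != 0) -> in_closure x ->
    (forall f, S f -> evU iota (join x y) f = 0) ->
  exists x', [/\ exists i, x' i != 0, in_closure x'
    & forall f, S f -> evU iota (join x' b) f = 0].
Proof.
move=> Shom x_neq0 xV xS.
have scale f (t : U) v w z : S f -> (forall i, w i = t * v i) ->
    evU iota (join v z) f = 0 -> evU iota (join w z) f = 0.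
  move=> Sf vw; have [d fd] := Shom f Sf.
  by apply: (evU_scale (t := t) fd) => -[j|j] //=.
pose q01 (i : 'I_2) : {poly F} := if i == 0 then 1 else 'X.
pose q10 (i : 'I_2) : {poly F} := if i == 0 then 'X else 1.
have q01E c i : vec2 1 c i = (map_poly iota (q01 i)).[c].
  by rewrite /q01 /vec2; case: ifP => _; rewrite ?rmorph1 ?map_polyX ?hornerE.
have q10E c i : vec2 c 1 i = (map_poly iota (q10 i)).[c].
  by rewrite /q10 /vec2; case: ifP => _; rewrite ?rmorph1 ?map_polyX ?hornerE.
have [x1|x1] := eqVneq (x 1) 0.
  have x0 : x 0 != 0.
    by case: x_neq0 => i; rewrite vec2E /vec2 x1; case: ifP; rewrite ?eqxx.
  exists x; split=> // f Sf.
  have xE i : x i = x 0 * vec2 1 0 i.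
    by rewrite vec2E /vec2 x1; case: ifP => _; rewrite ?mulr1 ?mulr0.
  (* The point [[1 : 0]] is the solution [0] of the zero system in the chart [q01]; a relation of
     [0] is a condition on its constant coefficient alone and transfers by [alpha_beta]. *)
  apply: (scale f (x 0) (vec2 1 0)) => //.
  apply: (transfer_join (Q := fun=> 0) (q := q01) (c := 0) (x := vec2 1 0)) => //.
  - by move=> i; rewrite rmorph0 horner0 (derivation0 (der_derivation U i)).
  - by move=> i; rewrite rmorph0 horner0 (derivation0 (der_derivation U i)).
  - by move=> g; rewrite /ann !horner_coef0 !coef_map; exact: alpha_beta.
  apply: (scale f (x 0)^-1 x) (xS f Sf) => // i.
  by rewrite [x i]xE mulKf.
set c := x 0 / x 1; have cP : flow c by exact: in_closure_flow.
have xc i : vec2 c 1 i = (x 1)^-1 * x i.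
  by rewrite [x i]vec2E /vec2; case: ifP => _; rewrite ?mulVf // mulrC.
have [[c' c'P ann0]|[f f0 [u u0 fu]]] :=
  flow_finite U_DCF dA alpha_der beta_der alpha_cst beta_cst cP.
  exists (vec2 c' 1); split; first by exists 1; rewrite /vec2 /= oner_neq0.
    exact: flow_in_closure.
  move=> f Sf; apply: (transfer_join cP c'P ann0 (q10E c) (q10E c')).
  exact: (scale f (x 1)^-1 x _ _ Sf xc (xS f Sf)).
have [c0 P2 ann0] :=
  flow_infinite dA alpha_der beta_der alpha_cst beta_cst alpha_beta cP f0 u0 fu.
pose T i : {poly F} := - ((P i)`_1 *: 'X + (P i)`_0 *: 'X^2).
have zT i : der i c^-1 = (map_poly iota (T i)).[c^-1] by exact: infinite_flow.
(* [T i] has no constant term, so the point at infinity is stationary and is a legitimate target for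
   [transfer]. *)
have oT i : der i (0 : U) = (map_poly iota (T i)).[0].
  rewrite (derivation0 (der_derivation U i)) /T rmorphN rmorphD /= !map_polyZ.
  by rewrite map_polyX map_polyXn !hornerE /= mulr0 oppr0.
have zc i : vec2 1 c^-1 i = c^-1 * vec2 c 1 i.
  by rewrite /vec2; case: ifP => _; rewrite ?mulVf ?mulr1.
(* A homogeneous [g] vanishing on the flow vanishes at [[c : 1]], which is [[1 : 1/c]], and this
   vanishing transfers to [[1 : 0]]. *)
exists (vec2 1 0); split; first by exists 0; rewrite /vec2 /= oner_neq0.
  move=> g d gd gP.
  pose q i := map_poly (cst A) (q01 i).
  have E1 : evU iota (fun i => (map_poly alpha (q i)).[c^-1]) g
      = evU iota (vec2 1 c^-1) g.
    by apply: eq_evd => i; rewrite (map_alpha_hA alpha_cst) q01E.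
  have E2 : evU iota (fun i => (map_poly beta (q i)).[0]) g
      = evU iota (vec2 1 0) g.
    by apply: eq_evd => i; rewrite (map_alpha_hA beta_cst) q01E.
  rewrite -E2; apply: (transfer zT oT ann0); rewrite E1.
  apply: (evU_scale (t := c^-1) gd zc).
  exact: (flow_in_closure cP gd).
move=> g Sg; apply: (transfer_join zT oT ann0 (q01E c^-1) (q01E 0)).
apply: (scale g c^-1 (vec2 c 1) _ _ Sg zc).
exact: (scale g (x 1)^-1 x _ _ Sg xc (xS g Sg)).
Qed.

End SpecialPoint.

End Completeness.

(** * Closedness of projections *)

Theorem theorem5p1 (m : nat) (F U : dfieldType m)
    (iota : {rmorphism F -> U}) (iota_der : dmorphism iota)
    (F_DCF : DCF F) (U_DCF : DCF U) (U_sat : saturated_over F U)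
    (P : 'I_m -> {poly F}) :
  dcomplete iota (dclosure iota (poly_flow iota P)).
Proof.
split=> [|k Y _ Z [S [Shom ZE]]]; first exact: dclosure_closed.
pose V := dclosure iota (poly_flow iota P).
(* The projection is taken over the whole projective space; once it is closed, intersecting with [Y]
   gives the required trace. *)
pose E := snd @` (Z `&` (V `*` setT)).
exists (dclosure iota E); first exact: dclosure_closed.
suff sub : dclosure iota E `<=` E.
  apply/seteqP; split=> y.
    by move=> [p [Zp [Vp Yp]] <-]; split=> // C _; apply; exists p.
  by move=> [Yy /sub[p [Zp [Vp _]] py]]; exists p => //; split=> //; split; rewrite ?py.
pose S' : set (diffpoly F ('I_2 + 'I_k.+1)%type) := [set f | S (of_dp f)].
have ZP p : Z p <-> forall f, S' f -> evU iota (join (hcoord p.1) (hcoord p.2)) f = 0.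
  rewrite ZE; split=> [/= H f /H /dzero_of_dp //|H f Sf].
  by apply/dzeroE; apply: H; rewrite /S' /= dp_ofK.
have Sl f : S' f -> exists d, homogeneous (@left_index k) d f.
  by move=> /Shom[d [_ [/dhomogE fd _]]]; exists d; rewrite of_dpK in fd.
have Sr f : S' f -> exists d, homogeneous (@right_index k) d f.
  by move=> /Shom[_ [d [_ /dhomogE fd]]]; exists d; rewrite of_dpK in fd.
have scale f (t : U) x v w : S' f -> (forall i, w i = t * v i) ->
    evU iota (join x v) f = 0 -> evU iota (join x w) f = 0.
  move=> Sf vw; have [d fd] := Sr f Sf.
  by apply: (evU_scale iota_der (t := t) fd) => -[j|j] //=.
have VP p : V p <-> in_closure iota P (hcoord p) by exact: dclosureE.
move=> b /dclosureE bE; have [j bj] := hcoord_neq0 b.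
(* Specialization concerns affine coordinates, so [b] is normalized to have coordinate [j] equal to
   [1], and [base] imposes the same on the points above. *)
pose bb i := hcoord b i / hcoord b j.
pose x_of (a : 'I_(2 + k.+1) -> U) (i : 'I_2) := a (lshift k.+1 i).
pose y_of (a : 'I_(2 + k.+1) -> U) (i : 'I_k.+1) := a (rshift 2 i).
pose base a := [/\ exists i, x_of a i != 0, in_closure iota P (x_of a),
  forall f, S' f -> evU iota (join (x_of a) (y_of a)) f = 0 & y_of a j = 1].
have [||a [xa0 xaV xaS _] aspec] :=
  generic_point iota_der U_sat (r := @rshift 2 k.+1) (b := bb) (base := base).
(* Each clause of [base] is a conjunction of formulas over [F]; the first one negates the
   simultaneous vanishing of both coordinates. *)
- move=> a aH; split.
  + have [z0 z0E] := zero_formula iota_der (@lshift 2 k.+1) (X (diffpoly F 'I_2) 0).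
    have [z1 z1E] := zero_formula iota_der (@lshift 2 k.+1) (X (diffpoly F 'I_2) 1).
    have := aH (FNot (FAnd z0 z1)); rewrite /= z0E z1E /evU !evd_X => H.
    apply: contrapT => /forallNP x0; apply: H => [a' [[i xi] _ _ _]|].
      move=> [/z0E + /z1E]; rewrite /evU !evd_X => a0 a1.
      by move/eqP: xi; apply; rewrite (vec2E (x_of a')) /vec2 /x_of a0 a1; case: ifP.
    by split; apply/eqP; apply: contrapT => /negP; exact: x0.
  + move=> f d fd fP; have [z zE] := zero_formula iota_der (@lshift 2 k.+1) f.
    by apply/zE/aH => a' [_ a'V _ _]; apply/zE; exact: a'V fd fP.
  + move=> f Sf; pose r (i : 'I_2 + 'I_k.+1) : 'I_(2 + k.+1) :=
      match i with inl i => lshift k.+1 i | inr i => rshift 2 i end.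
    have rE a' : evU iota (join (x_of a') (y_of a')) f = evU iota (fun i => a' (r i)) f.
      by apply: eq_evd => -[].
    have [z zE] := zero_formula iota_der r f.
    by rewrite rE; apply/zE/aH => a' [_ _ a'S _]; apply/zE; rewrite -rE; exact: a'S.
  + have [z zE] := zero_formula iota_der (@rshift 2 k.+1) (X (diffpoly F 'I_k.+1) j - 1).
    have evE a' : evU iota (fun i => a' (rshift 2 i)) (X (diffpoly F 'I_k.+1) j - 1) =
        y_of a' j - 1 by rewrite rmorphB rmorph1 /evU evd_X.
    apply/eqP; rewrite -subr_eq0 -evE; apply/eqP/zE/aH => a' [_ _ _ a'j].
    by apply/zE; rewrite evE a'j subrr.
- move=> g gb; apply: contrapT => no_a.
  have [d [g' [g'd g'E]]] := homogenization iota_der j g.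
  (* If [g] vanished at all normalized points of [E], its homogenization times [X j] would vanish on
     all of [E], the factor [X j] covering the points outside the chart. It would then vanish at
     [b], although [g] does not vanish at [bb]. *)
  have /eqP : evU iota (hcoord b) (X _ j * g') = 0.
    apply: (bE _ (1 + d)%N); first by apply: homogeneousM => //; exact: homogeneousX.
    move=> _ [p [Zp [Vp _]] <-]; rewrite rmorphM {1}/evU evd_X.
    have [->|ej] := eqVneq (hcoord p.2 j) 0; first by rewrite mul0r.
    rewrite g'E //; set y := fun i => _.
    suff -> : evU iota y g = 0 by rewrite !mulr0.
    apply/eqP; apply: contrapT => /negP gy; apply: no_a.
    pose a (i : 'I_(2 + k.+1)) :=
      match fintype.split i with inl i => hcoord p.1 i | inr i => y i end.
    have xaE : x_of a = hcoord p.1.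
      by apply: funext => i; rewrite /x_of /a (unsplitK (inl i)).
    have yaE : y_of a = y.
      by apply: funext => i; rewrite /y_of /a (unsplitK (inr i)).
    exists a; last by move: gy; rewrite -yaE.
    split; rewrite ?xaE ?yaE.
    + exact: hcoord_neq0.
    + exact/VP.
    + move=> f Sf; apply: (scale f (hcoord p.2 j)^-1 _ (hcoord p.2)) => //.
        by move=> i; rewrite /y mulrC.
      exact: ((ZP p).1 Zp).
    + by rewrite /y divff.
  rewrite rmorphM {1}/evU evd_X g'E // !mulf_eq0 expf_eq0 (negPf bj) andbF /=.
  exact/negP.
(* The point over [bb] also lies over [b], by homogeneity in the second group of variables. *)
have [x' [x'0 x'V x'S]] := special_point iota_der U_DCF aspec Sl xa0 xaV xaS.
have [p pE] := hvec_of x'0; exists (p, b) => //; split.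
  apply/ZP => f Sf; apply: (scale f (hcoord b j) _ bb) => //=.
    by move=> i; rewrite /bb mulrC divfK.
  by rewrite pE; exact: x'S.
by split=> //=; apply/VP; rewrite pE.
Qed.
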